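(* There is an algorithm which, given an ordered BDD with respect to any total order $<$ on its variables $p_1,\ldots,p_n$, having $m$ output nodes and thus representing a function $f : \{0,1\}^n \to \{0,1\}^m$, computes a basis of the vector space $V(f) = \{ s \in \{0,1\}^n \mid \forall x \in \{0,1\}^n : f(x+s) = f(x)\}$ over the two-element field, in time polynomial in the size of the BDD.
   Context: $+$ denotes coordinatewise exclusive or on $\{0,1\}^n$; $V(f)$ is a vector space over the field $\{0,1\}$ (addition $+$, multiplication $\wedge$). A BDD (binary decision diagram) is an acyclic shared circuit built only from the constants false and true (leaves $0$, $1$) and, for each variable $p$, a binary if-then-else operator $p(A,B)$ meaning $(\neg p \vee A) \wedge (p \vee B)$ (if $p$ then $A$ else $B$); a node $p(A,B)$ is said to be labeled by $p$. It may have several designated output nodes; with $m$ output nodes it represents a function $\{0,1\}^n \to \{0,1\}^m$. A BDD is ordered with respect to a total order $<$ on the variables if for every node $p(A,B)$, each of $A,B$ is false, true, or of the form $q(\cdot,\cdot)$ with $p < q$. The size of a BDD is its number of nodes.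
   Formalization: Time polynomial in the number of nodes is claimed when every variable labels some node and the m output nodes are distinct; in general it is polynomial in n + m + size, since a constant BDD with one node on n variables already has a basis of n vectors of n bits. *)

(* Defs.v *)
From mathcomp Require Import all_boot all_algebra.

Set Implicit Arguments.
Unset Strict Implicit.
Unset Printing Implicit Defensive.

Import GRing.Theory.
Local Open Scope ring_scope.

(* Algorithms are programs of the WHILE language of N. D. Jones (Computability
   and Complexity from a Programming Perspective): imperative programs over
   binary trees, whose running time counts evaluated expression nodes,
   assignments, tests and sequencings.  Each counted step is a constant-time
   pointer operation, since trees can be stored with sharing and only the root
   of a tree can be tested.  Hence running in polynomial time here is the same
   as on a Turing machine as soon as the written-out result has polynomial
   size, which is the case for a list of at most n vectors of length n. *)

Inductive tree : Type := Nil | Cons of tree & tree.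

Definition is_nil (d : tree) : bool := if d is Nil then true else false.

Inductive expr : Type :=
| EVar of nat
| ENil
| ECons of expr & expr
| EHd of expr
| ETl of expr.

Inductive cmd : Type :=
| CAssign of nat & expr
| CSeq of cmd & cmd
| CIf of expr & cmd & cmd
| CWhile of expr & cmd.

Definition store : Type := nat -> tree.

Definition update (st : store) (k : nat) (d : tree) : store :=
  fun l => if l == k then d else st l.

Fixpoint eval_expr (st : store) (e : expr) : tree :=
  match e with
  | EVar k => st k
  | ENil => Nil
  | ECons e1 e2 => Cons (eval_expr st e1) (eval_expr st e2)
  | EHd e1 => if eval_expr st e1 is Cons d _ then d else Nil
  | ETl e1 => if eval_expr st e1 is Cons _ d then d else Nil
  end.

Fixpoint cost_expr (e : expr) : nat :=
  match e with
  | EVar _ | ENil => 1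
  | ECons e1 e2 => (cost_expr e1 + cost_expr e2).+1
  | EHd e1 | ETl e1 => (cost_expr e1).+1
  end.

(* [exec c st t st']: from [st], [c] terminates in [st'] after time [t]; in
   tests, [Nil] is false and every other tree is true. *)
Inductive exec : cmd -> store -> nat -> store -> Prop :=
| exec_assign k e st :
    exec (CAssign k e) st (cost_expr e).+1 (update st k (eval_expr st e))
| exec_seq c1 c2 st0 st1 st2 t1 t2 :
    exec c1 st0 t1 st1 -> exec c2 st1 t2 st2 ->
    exec (CSeq c1 c2) st0 (t1 + t2).+1 st2
| exec_if_true e c1 c2 st st' t :
    ~~ is_nil (eval_expr st e) -> exec c1 st t st' ->
    exec (CIf e c1 c2) st (cost_expr e + t).+1 st'
| exec_if_false e c1 c2 st st' t :
    is_nil (eval_expr st e) -> exec c2 st t st' ->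
    exec (CIf e c1 c2) st (cost_expr e + t).+1 st'
| exec_while_true e c st0 st1 st2 t1 t2 :
    ~~ is_nil (eval_expr st0 e) ->
    exec c st0 t1 st1 -> exec (CWhile e c) st1 t2 st2 ->
    exec (CWhile e c) st0 (cost_expr e + t1 + t2).+1 st2
| exec_while_false e c st :
    is_nil (eval_expr st e) ->
    exec (CWhile e c) st (cost_expr e).+1 st.

Lemma exec_det c st t1 st1 t2 st2 :
  exec c st t1 st1 -> exec c st t2 st2 -> t1 = t2 /\ st1 = st2.
Proof.
move=> H; elim: H t2 st2 => {c st t1 st1};
  intros; match goal with H : exec (_ _ _) _ _ _ |- _ => inversion H
                        | H : exec (_ _ _ _) _ _ _ |- _ => inversion H end;
  subst; try congruence;
  repeat (match goal with IH : forall t s, exec ?c ?st t s -> _,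
                              H : exec ?c ?st _ _ |- _ =>
            case: (IH _ _ H) => ? ?; clear IH end; subst); try by [];
  match goal with H : is_true (~~ is_nil ?d), H' : is_true (is_nil ?d) |- _ =>
    by rewrite H' in H end.
Qed.

(* Variable 0 holds the input at the start and the output at the end; all
   other variables are initially [Nil]. *)
Definition runs (P : cmd) (input : tree) (t : nat) (output : tree) : Prop :=
  exists st : store,
    exec P (fun k => if k == 0%N then input else Nil) t st /\ st 0%N = output.

(* A vertex of a diagram on [n] variables with [N] vertices: a leaf 0 or 1, or
   [Branch p A B], standing for "if p then A else B", where [A] and [B] are
   names of vertices (so that subdiagrams are shared). *)
Inductive node (n N : nat) : Type :=
| Leaf of 'F_2
| Branch of 'I_n & 'I_N & 'I_N.
Arguments Leaf {n N} _.
Arguments Branch {n N} _ _ _.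

(* Acyclicity is not a field: only ordered diagrams are used, and in those the
   labels strictly increase along edges, so that there is no cycle. *)
Record bdd (n m : nat) : Type := BDD {
  bdd_size : nat;
  bdd_nodes : bdd_size.-tuple (node n bdd_size);
  bdd_outputs : m.-tuple 'I_bdd_size }.

Definition node_at (n m : nat) (D : bdd n m) (i : 'I_(bdd_size D)) :
  node n (bdd_size D) := tnth (bdd_nodes D) i.
Arguments node_at {n m} D i.

Definition strict_total_order (T : eqType) (lt : rel T) : Prop :=
  [/\ irreflexive lt, transitive lt & forall p q, p != q -> lt p q || lt q p].

Definition label_above (n N : nat) (lt : rel 'I_n) (p : 'I_n)
    (v : node n N) : bool :=
  match v with Leaf _ => true | Branch q _ _ => lt p q end.

Definition ordered (n m : nat) (lt : rel 'I_n) (D : bdd n m) : Prop :=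
  forall i p A B, node_at D i = Branch p A B ->
    label_above lt p (node_at D A) /\ label_above lt p (node_at D B).

Inductive evaluates (n m : nat) (D : bdd n m) (x : 'rV['F_2]_n) :
  'I_(bdd_size D) -> 'F_2 -> Prop :=
| evaluates_leaf i b : node_at D i = Leaf b -> evaluates x i b
| evaluates_then i p A B b : node_at D i = Branch p A B ->
    x 0 p = 1 -> evaluates x A b -> evaluates x i b
| evaluates_else i p A B b : node_at D i = Branch p A B ->
    x 0 p = 0 -> evaluates x B b -> evaluates x i b.
Arguments evaluates {n m} D x _ _.

(* [f x 0 j] is the j-th coordinate of the row vector [f x]. *)
Definition represents (n m : nat) (D : bdd n m)
    (f : 'rV['F_2]_n -> 'rV['F_2]_m) : Prop :=
  forall x j, evaluates D x (tnth (bdd_outputs D) j) (f x 0 j).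

Definition all_variables_occur (n m : nat) (D : bdd n m) : Prop :=
  forall p : 'I_n, exists i A B, node_at D i = Branch p A B.

Definition V (n m : nat) (f : 'rV['F_2]_n -> 'rV['F_2]_m) :
  {set 'rV['F_2]_n} := [set s | [forall x, f (x + s) == f x]].

(* [basis_of], for a space given by its set of elements. *)
Definition is_basis (n : nat) (S : {set 'rV['F_2]_n})
    (b : seq 'rV['F_2]_n) : Prop :=
  free b /\ <<b>>%VS =i S.

(* Numbers (names of vertices and variables) are encoded in unary, which is
   harmless: they are bounded by the numbers of vertices and variables. *)

Definition enc_seq (T : Type) (enc : T -> tree) (s : seq T) : tree :=
  foldr (fun a d => Cons (enc a) d) Nil s.

Definition enc_nat (k : nat) : tree := iter k (Cons Nil) Nil.

Definition enc_bool (b : bool) : tree := if b then Cons Nil Nil else Nil.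

Definition enc_bit (b : 'F_2) : tree := enc_bool (b != 0).

Definition enc_node (n N : nat) (v : node n N) : tree :=
  match v with
  | Leaf b => Cons Nil (enc_bit b)
  | Branch p A B =>
      Cons (Cons Nil Nil) (Cons (enc_nat p) (Cons (enc_nat A) (enc_nat B)))
  end.

Definition enc_order (n : nat) (lt : rel 'I_n) : tree :=
  enc_seq (fun p => enc_seq (fun q => enc_bool (lt p q)) (enum 'I_n))
    (enum 'I_n).

Definition enc_obdd (n m : nat) (lt : rel 'I_n) (D : bdd n m) : tree :=
  Cons (Cons (enc_nat n) (enc_order lt))
       (Cons (enc_seq (@enc_node n (bdd_size D)) (bdd_nodes D))
             (enc_seq (fun i : 'I_(bdd_size D) => enc_nat i) (bdd_outputs D))).

Definition enc_vector (n : nat) (v : 'rV['F_2]_n) : tree :=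
  enc_seq (fun i => enc_bit (v 0 i)) (enum 'I_n).

Definition enc_vectors (n : nat) (b : seq 'rV['F_2]_n) : tree :=
  enc_seq (@enc_vector n) b.

Lemma F2_cases (a : 'F_2) : a = 0 \/ a = 1.
Proof. by case: a => [[|[|k]] Hk] //; [left|right]; apply/val_inj. Qed.

Lemma evaluates_fun (n m : nat) (D : bdd n m) x i b c :
  evaluates D x i b -> evaluates D x i c -> b = c.
Proof.
move=> Hb; elim: Hb c => {i b} [i b Ei c Hc | i p A B b Ei xp _ IH c Hc |
  i p A B b Ei xp _ IH c Hc]; inversion Hc as [j c' Ej | j q A' B' c' Ej xq Hc' |
  j q A' B' c' Ej xq Hc']; subst; rewrite Ei in Ej; case: Ej => // *; subst;
  by [exact: IH | rewrite xp in xq].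
Qed.

Lemma ordered_evaluates (n m : nat) (lt : rel 'I_n) (D : bdd n m) :
  strict_total_order lt -> ordered lt D ->
  forall x i, exists b, evaluates D x i b.
Proof.
case=> irr tr _ ord x.
pose rk (v : node n (bdd_size D)) :=
  if v is Branch p _ _ then #|[set q | lt p q]|.+1 else 0%N.
have drop p v : label_above lt p v -> (rk v < #|[set q | lt p q]|.+1)%N.
  case: v => //= q _ _ pq; rewrite ltnS; apply: proper_card.
  apply/properP; split; last by exists q; rewrite !inE ?irr.
  by apply/subsetP => r; rewrite !inE; apply: tr.
move=> i; move: {2}(rk _).+1 (ltnSn (rk (node_at D i))) => k.
elim: k i => // k IH i; rewrite ltnS.
case E: (node_at D i) => [b|p A B] lek.
  by exists b; apply: evaluates_leaf.
have [HA HB] := ord _ _ _ _ E.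
case: (F2_cases (x 0 p)) => xp.
  have [b Hb] := IH B (leq_trans (drop _ _ HB) lek).
  by exists b; apply: evaluates_else E xp Hb.
have [b Hb] := IH A (leq_trans (drop _ _ HA) lek).
by exists b; apply: evaluates_then E xp Hb.
Qed.

Lemma ordered_represents (n m : nat) (lt : rel 'I_n) (D : bdd n m) :
  strict_total_order lt -> ordered lt D ->
  (exists f, represents D f) /\
  (forall f g, represents D f -> represents D g -> f =1 g).
Proof.
move=> Hlt Hord; split; last first.
  move=> f g Hf Hg x; apply/rowP => j.
  exact: evaluates_fun (Hf x j) (Hg x j).
have ex x : exists y : 'rV['F_2]_m,
    forall j, evaluates D x (tnth (bdd_outputs D) j) (y 0 j).
  have [g Hg] := fin_all_exists (fun j : 'I_m =>
    ordered_evaluates Hlt Hord x (tnth (bdd_outputs D) j)).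
  by exists (\row_j g j) => j; rewrite mxE.
by have [f Hf] := fin_all_exists ex; exists f.
Qed.

Lemma V_submod (n m : nat) (f : 'rV['F_2]_n -> 'rV['F_2]_m) :
  submod_closed (mem (V f)).
Proof.
split=> [|a s t]; first by rewrite inE; apply/forallP => x; rewrite addr0.
rewrite !inE => /forallP Hs /forallP Ht; apply/forallP => x.
case: (F2_cases a) => ->; first by rewrite scale0r add0r.
by rewrite scale1r addrA (eqP (Ht _)).
Qed.

(* Main.v *)
(** For vertices [u], [v] of the diagram let [W u v] be the set of all shifts [s]
    with [u (x + s) = v x] for all [x].  It is empty or a coset of [V u], and for
    [u = p(A,B)], [v = p(C,D)] it is the union of
      [s_p = 0], [W A C] and [W B D]   with   [s_p = 1], [W A D] and [W B C];
    a vertex [A] whose label lies above [p] counts as [p(A,A)].  Affine spaces are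
    represented by generators of a linear space with one more (homogenizing)
    coordinate, and the only operation of linear algebra is the passage to the
    orthogonal complement, one equation at a time: from the generators violating
    the equation take one, add it to the others and drop it.  Applied twice it
    shrinks a generating list to at most [n + 1] vectors, so that the table of all
    [W u v] remains polynomial; it is filled in [n + 1] rounds over all pairs,
    since the children of a vertex have smaller rank in the order.  Finally [V f]
    is the intersection of the spaces [W o o] of the output vertices [o].

    For the running time, a function between types encoded by trees is feasible
    ([FP]) when some program computes it with polynomial time and output size; a
    list recursion preserves this if its intermediate values have polynomial
    size. *)

Require Import Defs.
From HB Require Import structures.
From mathcomp Require Import all_boot all_algebra zify.
(* MathComp also uses the names [Nil] and [Cons], for lists. *)
Import Defs.

Set Implicit Arguments.
Unset Strict Implicit.
Unset Printing Implicit Defensive.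

Import GRing.Theory.

(** * Polynomial-time functions *)

(** Polynomials are kept as functions generated by these rules, so that monotonicity and closure
    under composition are inductions and bounds are checked by applying constructors. The type
    [{poly nat}] only enters at the end. *)
Inductive pbound : (nat -> nat) -> Prop :=
| pbound_id : pbound (fun n => n)
| pbound_const c : pbound (fun _ => c)
| pbound_add f g : pbound f -> pbound g -> pbound (fun n => f n + g n)
| pbound_mul f g : pbound f -> pbound g -> pbound (fun n => f n * g n).

Lemma pbound_homo f : pbound f -> {homo f : a b / a <= b}.
Proof.
elim=> {f} // [c a b _|f g _ fle _ gle a b ab|f g _ fle _ gle a b ab].
- exact: leqnn.
- by rewrite leq_add ?fle ?gle.
- by rewrite leq_mul ?fle ?gle.
Qed.

Lemma pbound_comp f g : pbound f -> pbound g -> pbound (fun n => f (g n)).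
Proof. by elim=> {f} *; [|constructor 2|constructor 3|constructor 4]; auto. Qed.

Lemma pbound_poly f :
  pbound f -> exists p : {poly nat}, forall n, f n = p.[n]%R.
Proof.
elim=> {f} [|c|f g _ [p fp] _ [q gq]|f g _ [p fp] _ [q gq]].
- by exists 'X%R => n; rewrite hornerX.
- by exists (c%:P)%R => n; rewrite hornerC.
- by exists (p + q)%R => n; rewrite hornerD fp gq.
- by exists (p * q)%R => n; rewrite hornerM fp gq.
Qed.

Ltac pbound :=
  repeat first [ assumption | apply: pbound_id | apply: pbound_const
               | apply: pbound_add | apply: pbound_mul | apply: pbound_comp ].

(** * Encodings by trees and their sizes *)

Fixpoint tsize (d : tree) : nat :=
  if d is Cons a b then (tsize a + tsize b).+1 else 1.

Class Enc (X : Type) := enc : X -> tree.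
Arguments enc {X _} x : simpl never.
#[global] Hint Mode Enc ! : typeclass_instances.

#[global] Instance Enc_unit : Enc unit := fun _ => Nil.
#[global] Instance Enc_bool : Enc bool := enc_bool.
#[global] Instance Enc_nat : Enc nat := enc_nat.
#[global] Instance Enc_prod X Y (EX : Enc X) (EY : Enc Y) : Enc (X * Y) :=
  fun p => Cons (enc p.1) (enc p.2).
#[global] Instance Enc_seq X (EX : Enc X) : Enc (seq X) := enc_seq enc.
#[global] Instance Enc_sum X Y (EX : Enc X) (EY : Enc Y) : Enc (X + Y) :=
  fun s => match s with
           | inl a => Cons Nil (enc a)
           | inr b => Cons (Cons Nil Nil) (enc b)
           end.

Definition esize {X} {EX : Enc X} (x : X) : nat := tsize (enc x).

Lemma esize_gt0 {X} {EX : Enc X} (x : X) : 0 < esize x.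
Proof. by rewrite /esize; case: (enc x). Qed.

Lemma esize_pair {X Y} {EX : Enc X} {EY : Enc Y} (x : X) (y : Y) :
  esize (x, y) = (esize x + esize y).+1.
Proof. by []. Qed.

Lemma esize_nil {X} {EX : Enc X} : esize ([::] : seq X) = 1.
Proof. by []. Qed.

Lemma esize_cons {X} {EX : Enc X} (x : X) (s : seq X) :
  esize (x :: s) = (esize x + esize s).+1.
Proof. by []. Qed.

(** Each list ends in a [Nil], and the concatenation keeps only one of the two; hence the
    successor. *)
Lemma esize_cat {X} {EX : Enc X} (s1 s2 : seq X) :
  (esize (s1 ++ s2)).+1 = esize s1 + esize s2.
Proof. by elim: s1 => [|x s IH] //=; rewrite !esize_cons; lia. Qed.

Lemma size_lt_esize {X} {EX : Enc X} (s : seq X) : size s < esize s.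
Proof. by elim: s => // x s IH; rewrite esize_cons /=; lia. Qed.

Lemma esize_nat k : esize k = k.*2.+1.
Proof. by elim: k => // k; rewrite /esize /enc /= => ->; lia. Qed.

Lemma esize_bool (b : bool) : esize b <= 3.
Proof. by case: b. Qed.

Lemma esize_map_le {X Y} {EY : Enc Y} (F : X -> Y) (s : seq X) k c :
  size s <= k -> (forall x, esize (F x) <= c) -> esize (map F s) <= k * c.+1 + 1.
Proof.
move=> sk Fc; elim: s k sk => [|x s IH] k /=; first by rewrite esize_nil addn1.
case: k => // k sk; rewrite esize_cons mulSn.
by have := Fc x; have := IH _ sk; lia.
Qed.

(* [c] replaces the content of variable [k] by [d] and leaves the variables
   below [k] alone: variables are used as a stack, with top [k]. *)
Definition yields (c : cmd) (st : store) (k : nat) (d : tree) (t : nat) :=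
  exists t' st', [/\ exec c st t' st', t' <= t, st' k = d
    & forall j, j < k -> st' j = st j].

(** A program is required at every stack level [k], because composite programs run their parts above
    saved values; nothing is assumed about the variables above [k]. The bound [T] is common to all
    levels. *)
Definition FP {X Y} {EX : Enc X} {EY : Enc Y} (f : X -> Y) : Prop :=
  exists T, [/\ pbound T, forall x, esize (f x) <= T (esize x)
    & forall k, exists c, forall st x, st k = enc x ->
        yields c st k (enc (f x)) (T (esize x))].

Lemma update_same st k d : update st k d k = d.
Proof. by rewrite /update eqxx. Qed.

Lemma update_other st k d j : j != k -> update st k d j = st j.
Proof. by rewrite /update => /negbTE ->. Qed.

Ltac upd := rewrite ?update_same ?[update _ _ _ _]update_other ?update_same //;
            try lia.

Lemma FP_esize_bound {X Y} {EX : Enc X} {EY : Enc Y} (f : X -> Y) : FP f ->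
  exists2 B, pbound B & forall x, esize (f x) <= B (esize x).
Proof. by case=> T [pT sT _]; exists T. Qed.

Create HintDb fp.

(** * Closure properties of feasible functions *)

Section Basics.
Context {X Y Z : Type} {EX : Enc X} {EY : Enc Y} {EZ : Enc Z}.

Lemma FP_ext (f g : X -> Y) : f =1 g -> FP f -> FP g.
Proof.
move=> fg [T [pT sT cT]]; exists T; split=> // [x|k]; first by rewrite -fg.
by have [c Hc] := cT k; exists c => st x /Hc; rewrite fg.
Qed.

Lemma FP_expr (f : X -> Y) (e : nat -> expr) (s : nat) :
  (forall k, cost_expr (e k) = s) ->
  (forall k st x, st k = enc x -> eval_expr st (e k) = enc (f x)) ->
  (forall x, esize (f x) <= esize x + s) -> FP f.
Proof.
move=> Hs He Hsz; exists (fun n => n + s.+1); split; first by pbound.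
  by move=> x; have := Hsz x; lia.
move=> k; exists (CAssign k (e k)) => st x Hx; do 2 eexists; split.
- exact: exec_assign.
- by rewrite Hs; lia.
- by rewrite update_same; apply: He.
- by move=> j jk; upd.
Qed.

(** This serves for changes of type that leave the code alone, such as a pair read as a nonempty
    list or a number read as a list of units. *)
Lemma FP_recode (f : X -> Y) : (forall x, enc (f x) = enc x) -> FP f.
Proof.
move=> Hf; apply: (@FP_expr _ EVar 1) => //= [k st x ->//|x].
by rewrite /esize Hf; lia.
Qed.

Lemma FP_const (y : Y) : FP (fun _ : X => y).
Proof.
pose fix q d := if d is Cons a b then ECons (q a) (q b) else ENil.
apply: (@FP_expr _ (fun _ => q (enc y)) (tsize (enc y))) => [_|_ st x _|x].
- by elim: (enc y) => //= a -> b ->.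
- by elim: (enc y) => //= a -> b ->.
- by rewrite /esize; lia.
Qed.

Lemma FP_comp (f : Y -> Z) (g : X -> Y) : FP f -> FP g -> FP (fun x => f (g x)).
Proof.
move=> [T [pT sT cT]] [U [pU sU cU]].
exists (fun n => T (U n) + U n + 1); split; first by pbound.
  by move=> x; have := sT (g x); have := pbound_homo pT (sU x); lia.
move=> k; have [c Hc] := cU k; have [d Hd] := cT k.
exists (CSeq c d) => st x /Hc [t [st1 [E1 l1 /Hd V1 P1]]].
have [t2 [st2 [E2 l2 V2 P2]]] := V1.
do 2 eexists; split; first exact: exec_seq E1 E2.
- by have := pbound_homo pT (sU x); lia.
- by [].
- by move=> j jk; rewrite P2 // P1.
Qed.

(** The input stays in variable [k] while [f] is computed in [k.+1] and then [g] in [k.+2]; each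
    part leaves the lower variables alone. *)
Lemma FP_pair (f : X -> Y) (g : X -> Z) :
  FP f -> FP g -> FP (fun x => (f x, g x)).
Proof.
move=> [T [pT sT cT]] [U [pU sU cU]].
exists (fun n => T n + U n + 12); split; first by pbound.
  by move=> x; rewrite esize_pair; have := sT x; have := sU x; lia.
move=> k; have [c Hc] := cT k.+1; have [d Hd] := cU k.+2.
exists (CSeq (CAssign k.+1 (EVar k)) (CSeq c (CSeq (CAssign k.+2 (EVar k))
  (CSeq d (CAssign k (ECons (EVar k.+1) (EVar k.+2))))))) => st x Hx.
have [|t [st1 [E1 l1 V1 P1]]] := Hc (update st k.+1 (st k)) x; first by upd.
have [|t2 [st2 [E2 l2 V2 P2]]] := Hd (update st1 k.+2 (st1 k)) x.
  by upd; rewrite P1 //; upd.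
do 2 eexists; split.
- apply: exec_seq; first exact: exec_assign.
  apply: exec_seq E1 _; apply: exec_seq; first exact: exec_assign.
  by apply: exec_seq E2 _; apply: exec_assign.
- by rewrite /=; lia.
- by rewrite update_same /= V2 P2 // update_other ?V1 //; lia.
- by move=> j jk; upd; rewrite P2 ?update_other ?P1 ?update_other //; lia.
Qed.

Lemma FP_if (b : X -> bool) (f g : X -> Y) :
  FP b -> FP f -> FP g -> FP (fun x => if b x then f x else g x).
Proof.
move=> [B [pB sB cB]] [T [pT sT cT]] [U [pU sU cU]].
exists (fun n => B n + T n + U n + 12); split; first by pbound.
  by move=> x; have := sT x; have := sU x; case: (b x); lia.
move=> k; have [cb Hb] := cB k.+1; have [c Hc] := cT k; have [d Hd] := cU k.
exists (CSeq (CAssign k.+1 (EVar k)) (CSeq cb (CIf (EVar k.+1) c d))) => st x Hx.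
have [|t [st1 [E1 l1 V1 P1]]] := Hb (update st k.+1 (st k)) x; first by upd.
have K1 : st1 k = enc x by rewrite P1 // update_other //; lia.
case bx: (b x) V1 => V1.
  have [t2 [st2 [E2 l2 V2 P2]]] := Hc _ _ K1.
  do 2 eexists; split.
  - apply: exec_seq; first exact: exec_assign.
    by apply: exec_seq E1 _; apply: exec_if_true E2; rewrite /= V1.
  - by rewrite /=; lia.
  - by [].
  - by move=> j jk; rewrite P2 // P1 ?update_other //; lia.
have [t2 [st2 [E2 l2 V2 P2]]] := Hd _ _ K1.
do 2 eexists; split.
- apply: exec_seq; first exact: exec_assign.
  by apply: exec_seq E1 _; apply: exec_if_false E2; rewrite /= V1.
- by rewrite /=; lia.
- by [].
- by move=> j jk; rewrite P2 // P1 ?update_other //; lia.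
Qed.

End Basics.

Section Projections.
Context {X Y Z A : Type}.
Context {EX : Enc X} {EY : Enc Y} {EZ : Enc Z} {EA : Enc A}.

Lemma FP_id : FP (fun x : X => x).
Proof. exact: FP_recode. Qed.

Lemma FP_fst (f : X -> Y * Z) : FP f -> FP (fun x => (f x).1).
Proof.
apply: FP_comp; apply: (@FP_expr _ _ _ _ _ (fun k => EHd (EVar k)) 2) => //.
  by move=> k st [a b] /= ->.
by case=> a b; rewrite esize_pair /=; lia.
Qed.

Lemma FP_snd (f : X -> Y * Z) : FP f -> FP (fun x => (f x).2).
Proof.
apply: FP_comp; apply: (@FP_expr _ _ _ _ _ (fun k => ETl (EVar k)) 2) => //.
  by move=> k st [a b] /= ->.
by case=> a b; rewrite esize_pair /=; lia.
Qed.

Lemma FP_comp2 (h : Y -> Z -> A) (f : X -> Y) (g : X -> Z) :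
  FP (fun p => h p.1 p.2) -> FP f -> FP g -> FP (fun x => h (f x) (g x)).
Proof. move=> Hh Hf Hg; exact: FP_comp Hh (FP_pair Hf Hg). Qed.

End Projections.

Section ListsAndCases.
Context {X Y Z : Type} {EX : Enc X} {EY : Enc Y} {EZ : Enc Z}.

Lemma FP_cons (f : X -> Y) (s : X -> seq Y) :
  FP f -> FP s -> FP (fun x => f x :: s x).
Proof. by apply: (FP_comp2 (h := cons)); apply: FP_recode. Qed.

Lemma FP_succ (f : X -> nat) : FP f -> FP (fun x => (f x).+1).
Proof.
apply: FP_comp; apply: (@FP_expr _ _ _ _ _ (fun k => ECons ENil (EVar k)) 3) => //.
  by move=> k st a /= ->.
by move=> a; rewrite !esize_nat; lia.
Qed.

Lemma FP_behead (f : X -> seq Y) : FP f -> FP (fun x => behead (f x)).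
Proof.
apply: FP_comp; apply: (@FP_expr _ _ _ _ _ (fun k => ETl (EVar k)) 2) => //.
  by move=> k st [|a s] /= ->.
by case=> [|a s] //; rewrite esize_cons /=; lia.
Qed.

(** The codes of [a :: l] and [(a, l)] agree, so consing the input onto the value of [s] builds the
    argument of [f] without taking the list apart. *)
Lemma FP_case_seq (s : X -> seq Z) (f : X -> Z -> seq Z -> Y) (g : X -> Y) :
  FP s -> FP (fun p : X * (Z * seq Z) => f p.1 p.2.1 p.2.2) -> FP g ->
  FP (fun x => if s x is a :: l then f x a l else g x).
Proof.
move=> [B [pB sB cB]] [T [pT sT cT]] [U [pU sU cU]].
exists (fun n => B n + T (n + B n + 1) + U n + 24); split; first by pbound.
  move=> x; have := sU x; case sx: (s x) => [|a l]; first by lia.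
  have := sT (x, (a, l)); have := sB x; rewrite sx esize_pair /= => H1 H2 H3.
  have: T (esize x + esize (a, l)).+1 <= T (esize x + B (esize x) + 1).
    by apply: pbound_homo pT _ _ _; move: H1; rewrite esize_cons esize_pair; lia.
  by lia.
move=> k; have [cb Hb] := cB k.+1; have [c Hc] := cT k; have [d Hd] := cU k.
exists (CSeq (CAssign k.+1 (EVar k)) (CSeq cb (CIf (EVar k.+1)
  (CSeq (CAssign k (ECons (EVar k) (EVar k.+1))) c) d))) => st x Hx.
have [|t [st1 [E1 l1 V1 P1]]] := Hb (update st k.+1 (st k)) x; first by upd.
have K1 : st1 k = enc x by rewrite P1 // update_other //; lia.
have := sB x; case sx: (s x) V1 => [|a l] V1 sBx.
  have [t2 [st2 [E2 l2 V2 P2]]] := Hd _ _ K1.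
  do 2 eexists; split.
  - apply: exec_seq; first exact: exec_assign.
    by apply: exec_seq E1 _; apply: exec_if_false E2; rewrite /= V1.
  - by rewrite /=; lia.
  - by [].
  - by move=> j jk; rewrite P2 // P1 ?update_other //; lia.
have [|t2 [st2 [E2 l2 V2 P2]]] := Hc
  (update st1 k (eval_expr st1 (ECons (EVar k) (EVar k.+1)))) (x, (a, l)).
  by rewrite update_same /= K1 V1.
have: T (esize (x, (a, l))) <= T (esize x + B (esize x) + 1).
  by apply: pbound_homo pT _ _ _; move: sBx; rewrite esize_cons !esize_pair; lia.
move=> HT; do 2 eexists; split.
- apply: exec_seq; first exact: exec_assign.
  apply: exec_seq E1 _; apply: exec_if_true; first by rewrite /= V1.
  by apply: exec_seq E2; apply: exec_assign.
- by rewrite /=; lia.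
- by [].
- by move=> j jk; rewrite P2 // update_other ?P1 ?update_other //; lia.
Qed.

End ListsAndCases.

Lemma FP_head {X Y} {EX : Enc X} {EY : Enc Y} y0 (f : X -> seq Y) :
  FP f -> FP (fun x => head y0 (f x)).
Proof.
move=> Hf; apply: (FP_case_seq (f := fun _ y _ => y) Hf); last exact: FP_const.
exact: FP_fst (FP_snd FP_id).
Qed.

Lemma FP_case_sum {X Y A B} {EX : Enc X} {EY : Enc Y} {EA : Enc A} {EB : Enc B}
    (s : X -> A + B) (f : X -> A -> Y) (g : X -> B -> Y) :
  FP s -> FP (fun p : X * A => f p.1 p.2) -> FP (fun p : X * B => g p.1 p.2) ->
  FP (fun x => match s x with inl a => f x a | inr b => g x b end).
Proof.
move=> [C [pC sC cC]] [T [pT sT cT]] [U [pU sU cU]].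
have sz x : match s x with inl a => esize a | inr b => esize b end <= C (esize x).
  by apply: leq_trans (sC x); case: (s x) => a; rewrite /esize /=; lia.
exists (fun n => C n + T (n + C n + 1) + U (n + C n + 1) + 24); split.
- by pbound.
- move=> x; have := sz x; case: (s x) => a sCx.
    have /= := sT (x, a); rewrite esize_pair.
    have: T (esize x + esize a).+1 <= T (esize x + C (esize x) + 1).
      by apply: pbound_homo pT _ _ _; lia.
    by lia.
  have /= := sU (x, a); rewrite esize_pair.
  have: U (esize x + esize a).+1 <= U (esize x + C (esize x) + 1).
    by apply: pbound_homo pU _ _ _; lia.
  by lia.
move=> k; have [cb Hb] := cC k.+1; have [c Hc] := cT k; have [d Hd] := cU k.
(* The tag of [inl] is [Nil], which tests as false, so the program for [g] comes first. *)
exists (CSeq (CAssign k.+1 (EVar k)) (CSeq cb (CIf (EHd (EVar k.+1))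
  (CSeq (CAssign k (ECons (EVar k) (ETl (EVar k.+1)))) d)
  (CSeq (CAssign k (ECons (EVar k) (ETl (EVar k.+1)))) c)))) => st x Hx.
have [|t [st1 [E1 l1 V1 P1]]] := Hb (update st k.+1 (st k)) x; first by upd.
have K1 : st1 k = enc x by rewrite P1 // update_other //; lia.
have := sz x; case: (s x) V1 => a V1 sCx.
  have [|t2 [st2 [E2 l2 V2 P2]]] := Hc
    (update st1 k (eval_expr st1 (ECons (EVar k) (ETl (EVar k.+1))))) (x, a).
    by rewrite update_same /= K1 V1.
  have HT : T (esize (x, a)) <= T (esize x + C (esize x) + 1).
    apply: pbound_homo pT _ _ _; rewrite esize_pair; lia.
  do 2 eexists; split.
  - apply: exec_seq; first exact: exec_assign.
    apply: exec_seq E1 _; apply: exec_if_false; first by rewrite /= V1.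
    by apply: exec_seq E2; apply: exec_assign.
  - by rewrite /=; lia.
  - by [].
  - by move=> j jk; rewrite P2 // update_other ?P1 ?update_other //; lia.
have [|t2 [st2 [E2 l2 V2 P2]]] := Hd
  (update st1 k (eval_expr st1 (ECons (EVar k) (ETl (EVar k.+1))))) (x, a).
  by rewrite update_same /= K1 V1.
have HT : U (esize (x, a)) <= U (esize x + C (esize x) + 1).
  apply: pbound_homo pU _ _ _; rewrite esize_pair; lia.
do 2 eexists; split.
- apply: exec_seq; first exact: exec_assign.
  apply: exec_seq E1 _; apply: exec_if_true; first by rewrite /= V1.
  by apply: exec_seq E2; apply: exec_assign.
- by rewrite /=; lia.
- by [].
- by move=> j jk; rewrite P2 // update_other ?P1 ?update_other //; lia.
Qed.

(** * Recursion on lists *)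

Section Fold.
Context {X Y A : Type} {EX : Enc X} {EY : Enc Y} {EA : Enc A}.

(* The bound [B] is a hypothesis: repeated squaring shows that it does not
   follow from a polynomial bound for a single step. *)
Lemma FP_foldl (step : X -> A -> Y -> A) (init : X -> A) (l : X -> seq Y) B :
  pbound B ->
  (forall x l1 l2, l x = l1 ++ l2 ->
     esize (foldl (step x) (init x) l1) <= B (esize x)) ->
  FP (fun p : X * A * Y => step p.1.1 p.1.2 p.2) -> FP init -> FP l ->
  FP (fun x => foldl (step x) (init x) (l x)).
Proof.
move=> pB HB [T [pT sT cT]] [U [pU sU cU]] [L [pL sL cL]].
(* [S] bounds the cost of one pass through the loop: the argument of [T] bounds the size of
   [(x, a, y)], where 2 counts the two pairings, and 32 pays for the commands around [step]. *)
pose S n := T (n + B n + L n + 2) + 32.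
exists (fun n => B n + U n + L n + L n * S n + 32); split.
- by rewrite /S; pbound.
- by move=> x; have := HB x (l x) [::]; rewrite cats0 => /(_ erefl); lia.
move=> k; have [cl Hl] := cL k.+1; have [ci Hi] := cU k.+2.
have [c Hc] := cT k.+3.
(* Variable [k] keeps the input, [k.+1] the rest of the list and [k.+2] the accumulator; [step] is
   computed in [k.+3]. *)
pose body := CSeq (CAssign k.+3
    (ECons (ECons (EVar k) (EVar k.+2)) (EHd (EVar k.+1))))
  (CSeq c (CSeq (CAssign k.+2 (EVar k.+3)) (CAssign k.+1 (ETl (EVar k.+1))))).
exists (CSeq (CAssign k.+1 (EVar k)) (CSeq cl (CSeq (CAssign k.+2 (EVar k))
  (CSeq ci (CSeq (CWhile (EVar k.+1) body) (CAssign k (EVar k.+2))))))).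
move=> st x Hx.
(* Loop invariant: [l1] has been folded, [l2] is still to be read. *)
have loop l2 l1 st1 : l x = l1 ++ l2 -> st1 k = enc x -> st1 k.+1 = enc l2 ->
    st1 k.+2 = enc (foldl (step x) (init x) l1) ->
  exists t' st', [/\ exec (CWhile (EVar k.+1) body) st1 t' st',
    t' <= size l2 * S (esize x) + 2,
    st' k.+2 = enc (foldl (step x) (init x) (l x))
    & forall j, j < k -> st' j = st1 j].
  elim: l2 l1 st1 => [|y l2 IH] l1 st1 lx K K1 K2.
    do 2 eexists; split; first by apply: exec_while_false; rewrite /= K1.
    - by rewrite /=; lia.
    - by rewrite K2 lx cats0.
    - by [].
  set a := foldl _ _ l1 in K2.
  have [|t2 [st2 [E2 l2' V2 P2]]] := Hc
   (update st1 k.+3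
      (eval_expr st1 (ECons (ECons (EVar k) (EVar k.+2)) (EHd (EVar k.+1)))))
   (x, a, y).
    by rewrite update_same /= K K1 K2.
  pose st3 := update st2 k.+2 (st2 k.+3).
  have E3 : st2 k.+1 = enc (y :: l2) by rewrite P2 ?update_other // ; lia.
  have lx' : l x = rcons l1 y ++ l2 by rewrite cat_rcons.
  have [||||t4 [st4 [E4 l4 V4 P4]]] :=
      IH (rcons l1 y) (update st3 k.+1 (eval_expr st3 (ETl (EVar k.+1)))).
  - by [].
  - by rewrite /st3 !update_other ?P2 ?update_other //; lia.
  - by rewrite update_same /= /st3 update_other ?E3 //; lia.
  - by rewrite /st3 update_other ?update_same ?V2 ?foldl_rcons //; lia.
  do 2 eexists; split.
  - apply: exec_while_true E4; first by rewrite /= K1.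
    apply: exec_seq; first exact: exec_assign.
    apply: exec_seq; first exact: E2.
    by apply: exec_seq; apply: exec_assign.
  - have: T (esize (x, a, y)) <= T (esize x + B (esize x) + L (esize x) + 2).
      apply: pbound_homo pT _ _ _; rewrite !esize_pair.
      have := HB x _ _ lx; have := sL x; rewrite -/a.
      have := @esize_cat _ EY l1 (y :: l2); rewrite -lx esize_cons.
      by have := @size_lt_esize _ EY l1; lia.
    have -> : T (esize x + B (esize x) + L (esize x) + 2) = S (esize x) - 32.
      by rewrite /S addnK.
    have : 32 <= S (esize x) by rewrite /S leq_addl.
    by rewrite /= mulSn; lia.
  - by [].
  - by move=> j jk; rewrite P4 // /st3 !update_other ?P2 ?update_other //; lia.
have [|t [st1 [E1 l1 V1 P1]]] := Hl (update st k.+1 (st k)) x; first by upd.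
have [|t2 [st2 [E2 l2 V2 P2]]] := Hi (update st1 k.+2 (st1 k)) x.
  by upd; rewrite P1 //; upd.
have [||||t3 [st3 [E3 l3 V3 P3]]] := loop (l x) [::] st2.
- by [].
- by rewrite P2 ?update_other ?P1 ?update_other //; lia.
- by rewrite P2 ?update_other ?V1 //; lia.
- by rewrite V2.
do 2 eexists; split.
- apply: exec_seq; first exact: exec_assign.
  apply: exec_seq E1 _; apply: exec_seq; first exact: exec_assign.
  by apply: exec_seq E2 _; apply: exec_seq E3 _; apply: exec_assign.
- have: size (l x) * S (esize x) <= L (esize x) * S (esize x).
    by rewrite leq_mul2r; have := @size_lt_esize _ EY (l x); have := sL x; lia.
  by rewrite /=; lia.
- by rewrite update_same.
- move=> j jk; rewrite update_other ?P3 ?P2 ?update_other ?P1 ?update_other //; lia.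
Qed.

End Fold.

(* Syntax-directed search for feasibility proofs *)
#[global] Hint Extern 0 (FP _) => exact FP_id : fp.
#[global] Hint Extern 1 (FP _) =>
  lazymatch goal with |- FP (fun x => fst (@?f x)) => apply: (FP_fst (f := f))
  | |- FP (@fst _ _) => exact: (FP_fst FP_id) end : fp.
#[global] Hint Extern 1 (FP _) =>
  lazymatch goal with |- FP (fun x => snd (@?f x)) => apply: (FP_snd (f := f))
  | |- FP (@snd _ _) => exact: (FP_snd FP_id) end : fp.
#[global] Hint Extern 1 (FP (fun _ => (_, _))) => (apply: FP_pair) : fp.
#[global] Hint Extern 1 (FP (fun _ => _ :: _)) => (apply: FP_cons) : fp.
#[global] Hint Extern 1 (FP (fun _ => _.+1)) => (apply: FP_succ) : fp.
#[global] Hint Extern 1 (FP (fun _ => behead _)) => (apply: FP_behead) : fp.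
#[global] Hint Extern 1 (FP (fun _ => if _ then _ else _)) => (apply: FP_if) : fp.
#[global] Hint Extern 9 (FP _) => (exact: FP_const) : fp.
#[global] Hint Extern 2 (FP _) =>
  match goal with H : FP ?f |- FP (fun x => ?f (@?g x)) =>
    apply: (FP_comp (g := g) H) end : fp.

(** If the growth in one step is bounded independently of the accumulator, the growths add up over
    the list instead of compounding, which supplies the bound that [FP_foldl] asks for. *)
Lemma FP_foldl_add {X Y A} {EX : Enc X} {EY : Enc Y} {EA : Enc A}
    (step : X -> A -> Y -> A) (init : X -> A) (l : X -> seq Y) S :
  pbound S ->
  (forall x y a, esize (step x a y) <= esize a + S (esize x + esize y)) ->
  FP (fun p : X * A * Y => step p.1.1 p.1.2 p.2) -> FP init -> FP l ->
  FP (fun x => foldl (step x) (init x) (l x)).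
Proof.
move=> pS HS Hstep Hi Hl.
have [U pU sU] := FP_esize_bound Hi; have [L pL sL] := FP_esize_bound Hl.
apply: (FP_foldl (B := fun n => U n + L n * S (n + L n))) => //; first by pbound.
move=> x l1 l2 lx.
have: esize (foldl (step x) (init x) l1) <=
      esize (init x) + size l1 * S (esize x + L (esize x)).
  have: esize l1 <= L (esize x).
    apply: leq_trans (sL x); rewrite lx.
    by have := @esize_cat _ EY l1 l2; have := @esize_gt0 _ (Enc_seq EY) l2; lia.
  elim/last_ind: l1 {lx} => [|l1 y IH] /=; first by lia.
  rewrite foldl_rcons size_rcons -cats1 => Hsz.
  have := @esize_cat _ EY l1 [:: y]; rewrite esize_cons esize_nil => E.
  have := HS x y (foldl (step x) (init x) l1).
  have: S (esize x + esize y) <= S (esize x + L (esize x)).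
    by apply: pbound_homo pS _ _ _; have := @esize_gt0 _ (Enc_seq EY) l1; lia.
  have: esize l1 <= L (esize x) by lia.
  by move/IH; lia.
have: size l1 * S (esize x + L (esize x)) <=
      L (esize x) * S (esize x + L (esize x)).
  rewrite leq_mul2r; apply/orP; right.
  have := sL x; have := @size_lt_esize _ EY (l x).
  by rewrite lx size_cat; lia.
by have := sU x; lia.
Qed.

Lemma FP_rev {X Y} {EX : Enc X} {EY : Enc Y} (l : X -> seq Y) :
  FP l -> FP (fun x => rev (l x)).
Proof.
apply: FP_comp.
have catrevE (s t : seq Y) : catrev s t = foldl (fun a y => y :: a) t s.
  by elim: s t => //= y s IH t; rewrite IH.
apply: (FP_ext (fun s => esym (catrevE s [::]))).
apply: (FP_foldl_add (step := fun _ a y => y :: a) (init := fun=> [::])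
  (l := fun s => s) (S := fun n => n + 1)); auto 40 with fp.
  by pbound.
by move=> x y a; rewrite esize_cons; lia.
Qed.
#[global] Hint Extern 1 (FP (fun _ => rev _)) => (apply: FP_rev) : fp.

(** A list is extended cheaply only at the front, so the images are collected in reverse order and
    reversed at the end. *)
Lemma FP_map {X Y Z} {EX : Enc X} {EY : Enc Y} {EZ : Enc Z}
    (F : X -> Y -> Z) (l : X -> seq Y) :
  FP (fun p : X * Y => F p.1 p.2) -> FP l -> FP (fun x => map (F x) (l x)).
Proof.
move=> HF Hl; have [B pB sB] := FP_esize_bound HF.
have mapE x : rev (foldl (fun a y => F x y :: a) [::] (l x)) = map (F x) (l x).
  elim/last_ind: (l x) => // s y IH; rewrite foldl_rcons rev_cons IH.
  by rewrite map_rcons.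
apply: (FP_ext mapE); apply: FP_rev.
apply: (FP_foldl_add (step := fun x a y => F x y :: a) (init := fun=> [::])
  (S := fun n => B (n + 1) + 1)); auto 40 with fp.
- by pbound.
- move=> x y a; rewrite esize_cons; have := sB (x, y).
  by rewrite esize_pair /= !addn1; lia.
- apply: FP_cons; last by auto 40 with fp.
  by apply: (FP_comp2 (h := F)); auto 40 with fp.
Qed.

Lemma FP_cat {X Y} {EX : Enc X} {EY : Enc Y} (s t : X -> seq Y) :
  FP s -> FP t -> FP (fun x => s x ++ t x).
Proof.
apply: (FP_comp2 (h := cat)).
have catE (p : seq Y * seq Y) : foldl (fun a y => y :: a) p.2 (rev p.1) = p.1 ++ p.2.
  by case: p => s1 s2 /=; rewrite foldl_rev; elim: s1 => //= y s1 ->.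
apply: (FP_ext catE).
apply: (FP_foldl_add (step := fun _ a y => y :: a) (init := snd)
  (l := fun p => rev p.1) (S := fun n => n + 1)); auto 40 with fp.
- by pbound.
- by move=> x y a; rewrite esize_cons; lia.
Qed.
#[global] Hint Extern 1 (FP (fun _ => _ ++ _)) => (apply: FP_cat) : fp.

(** A unary number has the same code as a list of that many units, so iteration is a fold over such
    a list. *)
Lemma FP_iter {X A} {EX : Enc X} {EA : Enc A} (step : X -> A -> A)
    (init : X -> A) (k : X -> nat) B :
  pbound B ->
  (forall x j, j <= k x -> esize (iter j (step x) (init x)) <= B (esize x)) ->
  FP (fun p : X * A => step p.1 p.2) -> FP init -> FP k ->
  FP (fun x => iter (k x) (step x) (init x)).
Proof.
move=> pB HB Hs Hi Hk.
have iterE x (s : seq unit) :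
    foldl (fun a _ => step x a) (init x) s = iter (size s) (step x) (init x).
  elim/last_ind: s => // s y IH; rewrite foldl_rcons IH size_rcons.
  by rewrite iterS.
apply: (FP_ext (f := fun x => foldl (fun a _ => step x a) (init x) (nseq (k x) tt))).
  by move=> x; rewrite iterE size_nseq.
apply: (FP_foldl (step := fun x a _ => step x a) (l := fun x => nseq (k x) tt) pB).
- move=> x l1 l2 E; rewrite iterE; apply: HB.
  by have /(congr1 size) := E; rewrite size_nseq size_cat => ->; rewrite leq_addr.
- by apply: (FP_comp2 (h := step)); auto 40 with fp.
- by [].
- apply: FP_comp Hk; apply: FP_recode; elim=> // n IH.
  by change (Cons Nil (enc (nseq n tt)) = Cons Nil (enc n)); rewrite IH.
Qed.

Lemma FP_nth {X Y} {EX : Enc X} {EY : Enc Y} x0 (s : X -> seq Y) (i : X -> nat) :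
  FP s -> FP i -> FP (fun x => nth x0 (s x) (i x)).
Proof.
move=> Hs Hi.
have nthE x : head x0 (iter (i x) behead (s x)) = nth x0 (s x) (i x).
  elim: (i x) (s x) => [|n IH] [|y t]; rewrite ?iterSr //=.
  by rewrite (IH [::]) nth_nil.
apply: (FP_ext nthE); apply: FP_head.
have [B pB sB] := FP_esize_bound Hs.
apply: (FP_iter (step := fun _ s => behead s) pB); auto 40 with fp.
move=> x j _; apply: leq_trans (sB x); elim: j (s x) => //= j IH t.
apply: leq_trans (IH t); case: (iter j behead t) => // a l.
by rewrite /= esize_cons; lia.
Qed.

#[global] Hint Extern 1 (FP (fun _ => nth _ _ _)) => (apply: FP_nth) : fp.

(** * The algorithm *)

Notation vec := (seq bool).
Notation rawnode := (bool + nat * (nat * nat))%type.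

Definition xorv (u v : vec) : vec := [seq p.1 (+) p.2 | p <- zip u v].

Definition dot (u v : vec) : bool :=
  foldl (fun b p => b (+) (p.1 && p.2)) false (zip u v).

(** The first component is empty or holds the pivot, the first generator found to violate the
    equation [e]; the second collects the generators to be kept. *)
Definition cut_step (e : vec) (a : seq vec * seq vec) (v : vec) :
    seq vec * seq vec :=
  if dot e v then
    if a.1 is g :: _ then (a.1, xorv v g :: a.2) else ([:: v], a.2)
  else (a.1, v :: a.2).

Definition cut (L : seq vec) (e : vec) : seq vec :=
  (foldl (cut_step e) ([::], [::]) L).2.

(** For [std] a basis of the whole space this generates the orthogonal complement of [E]. *)
Definition perp (std E : seq vec) : seq vec := foldl cut std E.

(** Intersection by duality: [perp std L1] and [perp std L2] are systems of equations for the two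
    spans, to be imposed together with [e]. *)
Definition slice (std : seq vec) (e : vec) (L1 L2 : seq vec) : seq vec :=
  perp std (e :: perp std L1 ++ perp std L2).

(* A list without a vector of homogenizing coordinate [true] stands for the empty
   set.  It may still generate directions common to two disjoint affine spaces,
   which must not enter [join]. *)
Definition proper_part (L : seq vec) : seq vec :=
  if has (head false) L then L else [::].

Definition join (std L1 L2 : seq vec) : seq vec :=
  perp std (perp std (L1 ++ L2)).

(** Missing entries read as [[::]], so the rounds can start from an empty table. *)
Definition get (tbl : seq (seq (seq vec))) (i j : nat) : seq vec :=
  nth [::] (nth [::] tbl i) j.

(* The equations [s_p = 0] and [s_p = 1]; coordinate [0] is the homogenizing one,
   so that [s_p] has index [p.+1]. *)
Definition combine std tbl (p A B C D : nat) : seq vec :=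
  join std
    (proper_part (slice std (nth [::] std p.+1) (get tbl A C) (get tbl B D)))
    (proper_part (slice std (xorv (nth [::] std p.+1) (nth [::] std 0))
       (get tbl A D) (get tbl B C))).

Definition entry std (lt : seq (seq bool)) (nodes : seq rawnode) tbl i j :
    seq vec :=
  match nth (inl false) nodes i with
  | inl a =>
      match nth (inl false) nodes j with
      | inl b => if a (+) b then [::] else std
      | inr v => combine std tbl v.1 i i v.2.1 v.2.2
      end
  | inr u =>
      match nth (inl false) nodes j with
      | inl b => combine std tbl u.1 u.2.1 u.2.2 j j
      | inr v =>
          if nth false (nth [::] lt u.1) v.1 then
            combine std tbl u.1 u.2.1 u.2.2 j j
          else if nth false (nth [::] lt v.1) u.1 then
            combine std tbl v.1 i i v.2.1 v.2.2
          else combine std tbl u.1 u.2.1 u.2.2 v.2.1 v.2.2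
      end
  end.

Definition round std lt nodes (idx : seq nat) tbl : seq (seq (seq vec)) :=
  [seq [seq entry std lt nodes tbl i j | j <- idx] | i <- idx].

(* [std] has [n.+1] elements and serves as the counter of the rounds. *)
Definition table std lt nodes idx : seq (seq (seq vec)) :=
  foldl (fun tbl _ => round std lt nodes idx tbl) [::] std.

(** The first equation sets the homogenizing coordinate to 0, so the result consists of directions,
    and [behead] removes a coordinate that is always [false]. *)
Definition invariance std tbl (outs : seq nat) : seq vec :=
  map behead (perp std
    (nth [::] std 0 :: flatten [seq perp std (get tbl j j) | j <- outs])).

Fixpoint stdbasis (k : nat) : seq vec :=
  if k is k'.+1 then (true :: nseq k' false) :: map (cons false) (stdbasis k')
  else [::].

Definition main (inp : (nat * seq (seq bool)) * (seq rawnode * seq nat)) :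
    seq vec :=
  let std := stdbasis inp.1.1.+1 in
  invariance std (table std inp.1.2 inp.2.1 (iota 0 (size inp.2.1))) inp.2.2.

(** * The algorithm is feasible *)

Section BoolsAndLists.
Context {X : Type} {EX : Enc X}.

Lemma FP_addb (a b : X -> bool) : FP a -> FP b -> FP (fun x => a x (+) b x).
Proof.
move=> Ha Hb; apply: (FP_ext (f := fun x =>
  if a x then if b x then false else true else b x)).
  by move=> x; case: (a x); case: (b x).
by auto 40 with fp.
Qed.

Lemma FP_andb (a b : X -> bool) : FP a -> FP b -> FP (fun x => a x && b x).
Proof.
move=> Ha Hb; apply: (FP_ext (f := fun x => if a x then b x else false)) => //.
by auto 40 with fp.
Qed.

Lemma FP_has {Y} {EY : Enc Y} (F : X -> Y -> bool) (l : X -> seq Y) :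
  FP (fun p : X * Y => F p.1 p.2) -> FP l -> FP (fun x => has (F x) (l x)).
Proof.
move=> HF Hl.
have hasE x : foldl (fun b y => if b then true else F x y) false (l x) =
    has (F x) (l x).
  have H s b : foldl (fun b y => if b then true else F x y) b s = b || has (F x) s.
    by elim: s b => [|y s IH] [] //=; rewrite IH.
  exact: H.
apply: (FP_ext hasE).
apply: (FP_foldl_add (step := fun x b y => if b then true else F x y)
  (init := fun=> false) (S := fun=> 3)); auto 40 with fp.
- by pbound.
- by move=> x y b; case: b; case: (F x y).
- apply: FP_if; auto 40 with fp.
  by apply: (FP_comp2 (h := F)); auto 40 with fp.
Qed.

Lemma FP_flatten {Y} {EY : Enc Y} (s : X -> seq (seq Y)) :
  FP s -> FP (fun x => flatten (s x)).
Proof.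
move=> Hs; apply: (FP_ext (f := fun x => foldl cat [::] (s x))).
  move=> x; elim/last_ind: (s x) => // t y IH.
  by rewrite foldl_rcons flatten_rcons IH.
apply: (FP_foldl_add (step := fun _ => cat) (init := fun=> [::])
  (S := fun n => n)); auto 40 with fp.
- by pbound.
- by move=> x y a; have := @esize_cat _ EY a y; lia.
Qed.

(** The state of the fold over the first list is the rest of the second list with the pairs found so
    far, in reverse; once the second list is used up, the state no longer changes. *)
Lemma FP_zip {Y Z} {EY : Enc Y} {EZ : Enc Z} (s : X -> seq Y) (t : X -> seq Z) :
  FP s -> FP t -> FP (fun x => zip (s x) (t x)).
Proof.
move=> Hs Ht.
pose step (a : seq Z * seq (Y * Z)) (y : Y) : seq Z * seq (Y * Z) :=
  if a.1 is z :: t then (t, (y, z) :: a.2) else a.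
have zipE x : rev (foldl step (t x, [::]) (s x)).2 = zip (s x) (t x).
  have H l u acc : rev (foldl step (u, acc) l).2 = rev acc ++ zip l u.
    elim: l u acc => [|y l IH] u acc /=; first by case: u => [|z u] /=; rewrite cats0.
    case: u => [|z u] /=; last by rewrite IH /= rev_cons cat_rcons.
    by rewrite cats0; elim: l {IH}.
  exact: H.
apply: (FP_ext zipE); apply: FP_rev; apply: FP_snd.
apply: (FP_foldl_add (step := fun _ => step) (S := fun n => 2 * n + 10));
  auto 40 with fp.
- by pbound.
- move=> x y [[|z u] r]; rewrite /step /= ?esize_pair ?esize_cons ?esize_pair; lia.
- apply: (FP_case_seq (f := fun p z t => (t, (p.2, z) :: p.1.2.2))
    (g := fun p : X * (seq Z * seq (Y * Z)) * Y => p.1.2)); auto 40 with fp.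
Qed.

End BoolsAndLists.

#[global] Hint Extern 1 (FP (fun _ => _ (+) _)) => (apply: FP_addb) : fp.
#[global] Hint Extern 1 (FP (fun _ => _ && _)) => (apply: FP_andb) : fp.
#[global] Hint Extern 1 (FP (fun _ => flatten _)) => (apply: FP_flatten) : fp.

Lemma esize_vec (v : vec) : esize v <= (4 * size v).+1.
Proof.
by elim: v => //= b v; rewrite esize_cons; have := esize_bool b; lia.
Qed.

Lemma size_vec (v : vec) : (size v).*2 < esize v.
Proof.
by elim: v => //= b v; rewrite esize_cons; have := @esize_gt0 _ Enc_bool b; lia.
Qed.

Lemma size_xorv u v : size (xorv u v) = minn (size u) (size v).
Proof. by rewrite size_map size_zip. Qed.

Section VecOps.
Context {X : Type} {EX : Enc X}.

Lemma FP_xorv (u v : X -> vec) : FP u -> FP v -> FP (fun x => xorv (u x) (v x)).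
Proof.
move=> Hu Hv; apply: (FP_map (F := fun _ p => p.1 (+) p.2)); auto 40 with fp.
exact: FP_zip.
Qed.

Lemma FP_dot (u v : X -> vec) : FP u -> FP v -> FP (fun x => dot (u x) (v x)).
Proof.
move=> Hu Hv; apply: (FP_foldl_add (step := fun _ b p => b (+) (p.1 && p.2))
  (init := fun=> false) (S := fun=> 3)); auto 40 with fp.
- by pbound.
- by move=> x [[] []] [].
- exact: FP_zip.
Qed.

End VecOps.

#[global] Hint Extern 1 (FP (fun _ => xorv _ _)) => (apply: FP_xorv) : fp.
#[global] Hint Extern 1 (FP (fun _ => dot _ _)) => (apply: FP_dot) : fp.

Lemma FP_cut {X} {EX : Enc X} (L : X -> seq vec) (e : X -> vec) :
  FP L -> FP e -> FP (fun x => cut (L x) (e x)).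
Proof.
move=> HL He; apply: FP_snd.
(* The sum [xorv v g] is no longer than [v], so the growth is bounded in terms of [v] alone,
   whatever the pivot [g] is. *)
apply: (FP_foldl_add (step := fun x => cut_step (e x))
  (init := fun=> ([::], [::])) (S := fun n => 5 * n + 10)); auto 40 with fp.
- by pbound.
- move=> x v [pv r]; rewrite /cut_step; case: ifP => _; last first.
    by rewrite !esize_pair esize_cons /=; lia.
  case: pv => [|g t] /=; rewrite ?esize_pair ?esize_cons ?esize_nil; first lia.
  have := esize_vec (xorv v g); rewrite size_xorv; have := size_vec v; lia.
- apply: FP_if; auto 40 with fp.
  by apply: (FP_case_seq
    (f := fun p g t => (p.1.2.1, xorv p.2 g :: p.1.2.2))
    (g := fun p => ([:: p.2], p.1.2.2))); auto 40 with fp.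
Qed.

(** Number and length of the vectors are bounded separately, since [cut] preserves both bounds. The
    size of the code is not preserved: a sum can have more true bits, and these have larger codes
    than false ones. *)
Definition thin (a b : nat) (L : seq vec) : bool :=
  (size L <= a) && all (fun v => size v <= b) L.

Lemma esize_thin a b L : thin a b L -> esize L <= a * (4 * b + 2) + 1.
Proof.
case/andP=> sL bL; apply: (@leq_trans (size L * (4 * b + 2) + 1)); last first.
  by rewrite leq_add2r leq_mul2r sL orbT.
elim: L bL {sL} => // v L IH /= /andP[vb /IH{}IH].
rewrite esize_cons mulSn; have := esize_vec v; lia.
Qed.

Lemma thin_cut a b e L : thin a b L -> thin a b (cut L e).
Proof.
case/andP=> sL bL; rewrite /thin /cut.
have H L' pv r : all (fun v => size v <= b) L' -> all (fun v => size v <= b) r ->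
    let c := (foldl (cut_step e) (pv, r) L').2 in
    size c <= size r + size L' /\ all (fun v => size v <= b) c.
  elim: L' pv r => [|v L' IH] pv r /=; first by rewrite addn0.
  case/andP=> vb bL' br; rewrite {2 4}/cut_step; case: ifP => _ /=; last first.
    have [//||sc bc] := IH pv (v :: r); first by rewrite /= vb.
    by split => //; move: sc => /=; lia.
  case: pv => [|g t].
    by have [//|//|sc bc] := IH [:: v] r; split => //; lia.
  have [//||sc bc] := IH (g :: t) (xorv v g :: r).
    by rewrite /= br andbT size_xorv geq_min vb.
  by split => //; move: sc => /=; lia.
have [sc bc] := H L [::] [::] bL isT; rewrite bc andbT; exact: leq_trans sc sL.
Qed.

Lemma thin_perp a b std E : thin a b std -> thin a b (perp std E).
Proof. by elim: E std => //= e E IH std /(thin_cut e) /IH. Qed.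

Definition thick (n : nat) : nat := n * (4 * n + 2) + 1.

Lemma pbound_thick : pbound thick.
Proof. by rewrite /thick; pbound. Qed.

(** Imposing an equation neither adds nor lengthens generators, so the bound is independent of
    [E]. *)
Lemma esize_perp std E : esize (perp std E) <= thick (esize std).
Proof.
apply: esize_thin; apply: thin_perp; apply/andP; split.
  by have := @size_lt_esize _ (Enc_seq Enc_bool) std; lia.
elim: std => //= v s IH; rewrite esize_cons; have := size_vec v.
move=> sv; apply/andP; split; first by lia.
by apply: sub_all IH => u; lia.
Qed.

Lemma FP_perp {X} {EX : Enc X} (s E : X -> seq vec) :
  FP s -> FP E -> FP (fun x => perp (s x) (E x)).
Proof.
move=> Hs HE; have [B pB sB] := FP_esize_bound Hs.
apply: (FP_foldl (step := fun _ => cut) (B := fun n => thick (B n)));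
  auto 40 with fp.
- exact: pbound_comp pbound_thick pB.
- move=> x l1 l2 _; apply: leq_trans (esize_perp _ _) _.
  exact: pbound_homo pbound_thick _ _ (sB x).
- by apply: FP_cut; auto 40 with fp.
Qed.

#[global] Hint Extern 1 (FP (fun _ => perp _ _)) => (apply: FP_perp) : fp.

Section Steps.
Context {X : Type} {EX : Enc X}.
Implicit Types (L s : X -> seq vec) (tbl : X -> seq (seq (seq vec))).

Lemma FP_get tbl i j : FP tbl -> FP i -> FP j ->
  FP (fun x => get (tbl x) (i x) (j x)).
Proof. by move=> Ht Hi Hj; do 2 apply: FP_nth => //. Qed.

Lemma FP_slice s e L1 L2 : FP s -> FP e -> FP L1 -> FP L2 ->
  FP (fun x => slice (s x) (e x) (L1 x) (L2 x)).
Proof. by rewrite /slice => *; auto 40 with fp. Qed.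

Lemma FP_proper_part L : FP L -> FP (fun x => proper_part (L x)).
Proof.
move=> HL; apply: FP_if; auto 40 with fp.
by apply: (FP_has (F := fun=> head false)) => //; apply: FP_head; auto with fp.
Qed.

Lemma FP_join s L1 L2 : FP s -> FP L1 -> FP L2 ->
  FP (fun x => join (s x) (L1 x) (L2 x)).
Proof. by rewrite /join => *; auto 40 with fp. Qed.

Lemma FP_combine s tbl p A B C D :
  FP s -> FP tbl -> FP p -> FP A -> FP B -> FP C -> FP D ->
  FP (fun x => combine (s x) (tbl x) (p x) (A x) (B x) (C x) (D x)).
Proof.
move=> *; apply: FP_join => //; apply: FP_proper_part; apply: FP_slice => //;
  try apply: FP_xorv; try apply: FP_get => //; auto 40 with fp.
Qed.

End Steps.

#[global] Hint Extern 1 (FP (fun _ => combine _ _ _ _ _ _ _)) =>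
  (apply: FP_combine) : fp.

Lemma FP_entry {X} {EX : Enc X} (s : X -> seq vec) (lt : X -> seq (seq bool))
    (nodes : X -> seq rawnode) (tbl : X -> seq (seq (seq vec))) (i j : X -> nat) :
  FP s -> FP lt -> FP nodes -> FP tbl -> FP i -> FP j ->
  FP (fun x => entry (s x) (lt x) (nodes x) (tbl x) (i x) (j x)).
Proof.
move=> Hs Hlt Hn Ht Hi Hj; rewrite /entry.
apply: (FP_case_sum (s := fun x => nth (inl false) (nodes x) (i x))); auto 40 with fp.
  apply: (FP_case_sum (s := fun p => nth (inl false) (nodes p.1) (j p.1)));
    auto 40 with fp.
apply: (FP_case_sum (s := fun p => nth (inl false) (nodes p.1) (j p.1)));
    auto 40 with fp.
Qed.

(** An entry is empty, is [s], or is a result of [perp s]. Its bound is therefore independent of the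
    old table [tbl], and sizes do not compound over the rounds. *)
Lemma esize_entry s lt nodes tbl i j :
  esize (entry s lt nodes tbl i j) <= thick (esize s) + esize s.
Proof.
have H p A B C D : esize (combine s tbl p A B C D) <= thick (esize s) + esize s.
  by apply: leq_trans (esize_perp _ _) _; apply: leq_addr.
rewrite /entry; case: (nth _ nodes i) => u; case: (nth _ nodes j) => v //.
  case: ifP => _; last exact: leq_addl.
  by rewrite esize_nil; apply: leq_trans (esize_gt0 s) (leq_addl _ _).
by case: ifP => _ //; case: ifP => _.
Qed.

Lemma FP_round {X} {EX : Enc X} (s : X -> seq vec) (lt : X -> seq (seq bool))
    (nodes : X -> seq rawnode) (idx : X -> seq nat) (tbl : X -> seq (seq (seq vec))) :
  FP s -> FP lt -> FP nodes -> FP idx -> FP tbl ->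
  FP (fun x => round (s x) (lt x) (nodes x) (idx x) (tbl x)).
Proof.
move=> Hs Hlt Hn Hi Ht.
apply: (FP_map (F := fun x i =>
  [seq entry (s x) (lt x) (nodes x) (tbl x) i j | j <- idx x])) => //.
apply: (FP_map (F := fun p j =>
  entry (s p.1) (lt p.1) (nodes p.1) (tbl p.1) p.2 j)); auto 40 with fp.
by apply: FP_entry; auto 40 with fp.
Qed.

Lemma esize_round s lt nodes idx tbl :
  esize (round s lt nodes idx tbl) <=
  esize idx * (esize idx * (thick (esize s) + esize s).+1).+2 + 1.
Proof.
have sz := @size_lt_esize _ Enc_nat idx.
apply: esize_map_le => [|i]; first exact: ltnW.
rewrite -addn1; apply: esize_map_le => [|j]; first exact: ltnW.
exact: esize_entry.
Qed.

Lemma FP_table {X} {EX : Enc X} (s : X -> seq vec) (lt : X -> seq (seq bool))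
    (nodes : X -> seq rawnode) (idx : X -> seq nat) :
  FP s -> FP lt -> FP nodes -> FP idx ->
  FP (fun x => table (s x) (lt x) (nodes x) (idx x)).
Proof.
move=> Hs Hlt Hn Hi.
have [B pB sB] := FP_esize_bound Hs; have [C pC sC] := FP_esize_bound Hi.
apply: (FP_foldl (step := fun x tbl _ => round (s x) (lt x) (nodes x) (idx x) tbl)
  (B := fun n => C n * (C n * ((thick (B n) + B n) + 1) + 2) + 1)); auto 40 with fp.
- by have := pbound_thick => pT; pbound.
- move=> x l1 l2 _; elim/last_ind: l1 => [|l1 v _] /=; first by rewrite esize_nil addn1.
  rewrite foldl_rcons; apply: leq_trans (esize_round _ _ _ _ _) _.
  have ht := pbound_homo pbound_thick (sB x).
  rewrite leq_add2r leq_mul ?sC // -addn2 leq_add2r leq_mul ?sC // addn1 ltnS.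
  by rewrite leq_add ?sB.
- by apply: FP_round; auto 40 with fp.
Qed.

Lemma FP_iota {X} {EX : Enc X} {Y} {EY : Enc Y} (l : X -> seq Y) :
  FP l -> FP (fun x => iota 0 (size (l x))).
Proof.
move=> Hl; have [B pB sB] := FP_esize_bound Hl.
(* Each pass shifts the interval up by one and puts 0 in front; the list folded over is only a
   counter. *)
have foldE (s : seq Y) : foldl (fun a _ => 0 :: map succn a) [::] s = iota 0 (size s).
  elim/last_ind: s => // s y IH; rewrite foldl_rcons IH size_rcons /=.
  by rewrite -[1]addn0 iotaDl.
apply: (FP_ext (fun x => foldE (l x))).
apply: (FP_foldl (step := fun _ a _ => 0 :: map succn a) (init := fun=> [::])
  (B := fun n => B n * (2 * B n + 2) + 1)); auto 40 with fp.
- by pbound.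
- move=> x l1 l2 E; rewrite foldE.
  have {E} sz : size l1 < B (esize x).
    apply: leq_trans (sB x); apply: leq_trans (size_lt_esize (l x)).
    by rewrite E size_cat; lia.
  have H n m : m + n <= B (esize x) ->
      esize (iota m n) <= n * (2 * B (esize x) + 2) + 1.
    elim: n m => //= n IH m mn; rewrite esize_cons esize_nat mulSn.
    by have := IH m.+1; lia.
  apply: leq_trans (H _ _ _) _; first by lia.
  by rewrite leq_add2r leq_mul2r; lia.
- apply: FP_cons; auto 40 with fp.
  by apply: (FP_map (F := fun=> succn)); auto 40 with fp.
Qed.

Lemma size_stdbasis k : size (stdbasis k) = k.
Proof. by elim: k => //= k IH; rewrite size_map IH. Qed.

Lemma all_stdbasis k : all (fun v => size v == k) (stdbasis k).
Proof. by elim: k => //= k IH; rewrite size_nseq eqxx /= all_map. Qed.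

Lemma FP_stdbasis {X} {EX : Enc X} (k : X -> nat) :
  FP k -> FP (fun x => stdbasis (k x)).
Proof.
move=> Hk; have [B pB sB] := FP_esize_bound Hk.
(* The zero vector of the current length is carried along as the tail of the next basis vector. *)
pose step (a : vec * seq vec) := (false :: a.1, (true :: a.1) :: map (cons false) a.2).
have iterE j : iter j step ([::], [::]) = (nseq j false, stdbasis j).
  by elim: j => //= j ->.
apply: (FP_ext (f := fun x => (iter (k x) step ([::], [::])).2)).
  by move=> x; rewrite iterE.
apply: FP_snd; apply: (FP_iter (step := fun=> step) (init := fun=> ([::], [::]))
  (B := fun n => 4 * B n + 1 + thick (B n) + 1)); auto 40 with fp.
- by have := pbound_thick => pT; pbound.
- move=> x j jk; rewrite iterE esize_pair.
  have jB : j <= B (esize x).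
    by apply: leq_trans (sB x); rewrite esize_nat; lia.
  have := esize_vec (nseq j false); rewrite size_nseq.
  have: thin (B (esize x)) (B (esize x)) (stdbasis j).
    rewrite /thin size_stdbasis jB; apply: sub_all (all_stdbasis j) => v /eqP ->.
    exact: jB.
  by move/esize_thin; rewrite -/(thick _); lia.
- apply: FP_pair; auto 40 with fp; apply: FP_cons; auto 40 with fp.
  by apply: (FP_map (F := fun=> cons false)); auto 40 with fp.
Qed.

Lemma FP_invariance {X} {EX : Enc X} (s : X -> seq vec)
    (tbl : X -> seq (seq (seq vec))) (outs : X -> seq nat) :
  FP s -> FP tbl -> FP outs -> FP (fun x => invariance (s x) (tbl x) (outs x)).
Proof.
move=> Hs Ht Ho; apply: (FP_map (F := fun=> behead)); auto 40 with fp.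
apply: FP_perp => //; apply: FP_cons; auto 40 with fp; apply: FP_flatten.
apply: (FP_map (F := fun x j => perp (s x) (get (tbl x) j j))) => //.
by apply: FP_perp; auto 40 with fp; apply: FP_get; auto 40 with fp.
Qed.

Lemma FP_main : FP main.
Proof.
have Hs : FP (fun inp : (nat * seq (seq bool)) * (seq rawnode * seq nat) =>
    stdbasis inp.1.1.+1) by apply: FP_stdbasis; auto 40 with fp.
apply: FP_invariance; [exact: Hs|apply: FP_table|]; auto 40 with fp.
by apply: FP_iota; auto 40 with fp.
Qed.

(** * Linear algebra over bit vectors *)

Local Open Scope ring_scope.

Notation wf k := (all (fun v : seq bool => size v == k)).

Section Vectors.
Variable k : nat.
Implicit Types (u v e : vec) (L E : seq vec) (x y : 'rV['F_2]_k).

(** A list of another length is padded with zeros or truncated; lengths are therefore tracked by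
    [wf]. *)
Definition dec v : 'rV['F_2]_k := \row_i (nth false v i)%:R.

Definition vspan L : {vspace 'rV['F_2]_k} := <<map dec L>>%VS.

Definition dotp x y : 'F_2 := \sum_i x 0 i * y 0 i.

Lemma dotpD x y z : dotp x (y + z) = dotp x y + dotp x z.
Proof. by rewrite -big_split; apply: eq_bigr => i _; rewrite mxE mulrDr. Qed.

Lemma dotp0 x : dotp x 0 = 0.
Proof. by rewrite /dotp big1 // => i _; rewrite mxE mulr0. Qed.

Lemma dotpC x y : dotp x y = dotp y x.
Proof. by apply: eq_bigr => i _; rewrite mulrC. Qed.

Lemma dotpDl x y z : dotp (x + y) z = dotp x z + dotp y z.
Proof. by rewrite dotpC dotpD !(dotpC z). Qed.

Lemma addb_F2 (a b : bool) : (a (+) b)%:R = a%:R + b%:R :> 'F_2.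
Proof. by case: a; case: b; apply/val_inj. Qed.

Lemma andb_F2 (a b : bool) : (a && b)%:R = a%:R * b%:R :> 'F_2.
Proof. by case: a; case: b; apply/val_inj. Qed.

Lemma natr_bool_eq0 (b : bool) : (b%:R == 0 :> 'F_2) = ~~ b.
Proof. by case: b. Qed.

Lemma dec_xorv u v : size u = k -> size v = k ->
  dec (xorv u v) = dec u + dec v.
Proof.
move=> su sv; apply/rowP => i; rewrite !mxE -addb_F2.
by rewrite (nth_map (false, false)) ?size_zip ?su ?sv ?minnn // nth_zip ?su.
Qed.

Lemma dec_dot u v : size u = k -> size v = k ->
  (dot u v)%:R = dotp (dec u) (dec v).
Proof.
move=> su sv; rewrite /dotp.
under eq_bigr do rewrite !mxE; rewrite -{}su in sv *.
have H c : (foldl (fun b p => b (+) (p.1 && p.2)) c (zip u v))%:R =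
    c%:R + \sum_(i < size u) (nth false u i)%:R * (nth false v i)%:R :> 'F_2.
  elim: u v c sv => [|a u IH] [|b v] c //= => [_|[sv]].
    by rewrite big_ord0 addr0.
  by rewrite IH // big_ord_recl /= addb_F2 andb_F2 addrA.
by rewrite /dot H add0r.
Qed.

Lemma addxx_F2 x : x + x = 0.
Proof. by apply/rowP => i; rewrite !mxE addrr_pchar2 // pchar_Fp. Qed.

Lemma addxK_F2 y x : x + y + y = x.
Proof. by rewrite -addrA addxx_F2 addr0. Qed.

(** The line through [dec v] contains only 0 and [dec v], and subtraction is addition. *)
Lemma memF2_span_cons x L v :
  (x \in vspan (v :: L)) = (x \in vspan L) || (x + dec v \in vspan L).
Proof.
rewrite /vspan /= span_cons; apply/idP/idP.
  case/memv_addP => _ /vlineP[a ->] [y yL ->].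
  case: (F2_cases a) => ->; first by rewrite scale0r add0r yL.
  by rewrite scale1r addrAC addxx_F2 add0r yL orbT.
case/orP => H; first by rewrite -[x]add0r memv_add ?mem0v.
by rewrite -[x](addxK_F2 (dec v)) addrC memv_add // memv_line.
Qed.

(** Adding the pivot to other generators keeps the span, and in the end all generators but the pivot
    satisfy the equation. A combination that uses the pivot violates it, so dropping the pivot
    leaves exactly the solutions. Freeness is a count: span and number of vectors are unchanged
    until the pivot is dropped. *)
Lemma cutP e L : size e = k -> wf k L ->
  [/\ wf k (cut L e),
      forall x, (x \in vspan (cut L e)) = (x \in vspan L) && (dotp (dec e) x == 0)
    & free (map dec L) -> free (map dec (cut L e))].
Proof.
move=> se wL.
have [wp wr sz sp [r0 p1]] : let st := foldl (cut_step e) ([::], [::]) L in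
  [/\ wf k st.1, wf k st.2, (size st.1 + size st.2 = size L)%N,
      vspan (st.1 ++ st.2) = vspan L &
      all (fun v => dotp (dec e) (dec v) == 0) st.2 /\
      (st.1 = [::] \/ exists2 g, st.1 = [:: g] & dotp (dec e) (dec g) = 1)].
  elim/last_ind: L wL => [|L v IH]; first by split => //; split => //; left.
  rewrite all_rcons => /andP[/eqP sv /IH]; rewrite foldl_rcons.
  case: (foldl _ _ L) => p r /= [wp wr sz sp [r0 p1]] {IH}.
  have spv M : vspan M = vspan L -> vspan (v :: M) = vspan (rcons L v).
    move=> E; rewrite /vspan map_rcons -cats1 span_cat /= span_cons span_seq1.
    by rewrite addvC -/(vspan M) E.
  have dv := dec_dot se sv.
  rewrite /cut_step /=; case: ifP dv => _ /esym dv; last first.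
    split=> //=; first by rewrite sv eqxx.
    - by rewrite addnS sz size_rcons.
    - rewrite -(spv (p ++ r)) //; apply: eq_span; apply: eq_mem_map => y.
      by rewrite mem_cat !inE mem_cat orbCA.
    - by rewrite dv.
  case: p1 wp sz sp => [->|[g -> dg]] /= wp sz sp.
    split=> //=; first by rewrite sv eqxx.
    - by rewrite size_rcons -sz.
    - by rewrite -(spv r).
    - by split=> //; right; exists v.
  move: wp; rewrite andbT => /eqP sg.
  split=> //=; rewrite ?sg ?eqxx //.
  - by rewrite size_xorv sv sg minnn eqxx.
  - by rewrite size_rcons -sz.
  - rewrite -(spv (g :: r)) //; apply/vspaceP => x.
    (* Both memberships become disjunctions over the same four vectors: [x], [x + dec v],
       [x + dec g] and [x + dec v + dec g], tested against the span of [r]. *)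
    rewrite !memF2_span_cons dec_xorv // !addrA [x + dec g + _]addrAC.
    rewrite addxK_F2.
    by rewrite [_ + dec v + dec g]addrAC; do 4 case: (_ \in _).
  - split; last by right; exists g.
    by rewrite dec_xorv // dotpD /= dv dg r0 andbT addrr_pchar2 // pchar_Fp.
set st := foldl _ _ L in wp wr sz sp r0 p1; have E : cut L e = st.2 by [].
have r0' x : x \in vspan st.2 -> dotp (dec e) x = 0.
  elim: (st.2) x r0 => [|v r IH] x /=.
    by rewrite /vspan span_nil memv0 => _ /eqP ->; rewrite dotp0.
  case/andP=> /eqP v0 /IH{}IH; rewrite memF2_span_cons => /orP[/IH//|/IH].
  by rewrite dotpD /= v0 addr0.
rewrite E; split=> //.
  move=> x; rewrite -sp; case: p1 => [->|[g -> dg]] /=.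
    by apply/idP/andP => [H|[]//]; rewrite r0'.
  rewrite memF2_span_cons; apply/idP/andP => [H|[/orP[//|/r0']]].
    by rewrite H r0'.
  by rewrite dotpD /= dg => /eqP; rewrite addr_eq0 => /eqP -> .
move=> fL; have: free (map dec (st.1 ++ st.2)).
  by rewrite /free -/(vspan _) sp size_map size_cat sz -(size_map dec) -/(free _).
by rewrite map_cat => /catr_free.
Qed.

Lemma perpP E std : wf k std -> wf k E ->
  [/\ wf k (perp std E),
      forall x, (x \in vspan (perp std E)) =
        (x \in vspan std) && all (fun e => dotp (dec e) x == 0) E
    & free (map dec std) -> free (map dec (perp std E))].
Proof.
elim: E std => [|e E IH] std /= ws; first by split=> // x; rewrite andbT.
case/andP=> /eqP se wE; have [wc mc fc] := cutP se ws.
have [wp mp fp] := IH _ wc wE; split=> // [x|/fc/fp//].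
by rewrite mp mc andbA.
Qed.

Lemma span_dotp0 L x y : all (fun v => dotp y (dec v) == 0) L ->
  x \in vspan L -> dotp y x = 0.
Proof.
elim: L x => [|v L IH] x /=.
  by rewrite /vspan span_nil memv0 => _ /eqP ->; rewrite dotp0.
case/andP=> /eqP v0 /IH{}IH; rewrite memF2_span_cons => /orP[/IH//|/IH].
by rewrite dotpD v0 addr0.
Qed.

Lemma mem_dec_span L v : v \in L -> dec v \in vspan L.
Proof. by move=> vL; apply: memv_span; apply: map_f. Qed.

Lemma dec_stdbasis (i : 'I_k) : dec (nth [::] (stdbasis k) i) = delta_mx 0 i.
Proof.
apply/rowP => j; rewrite !mxE eqxx /=; congr (_%:R).
have H n a b : (a < n)%N -> nth false (nth [::] (stdbasis n) a) b = (b == a).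
  elim: n a b => //= n IH [|a] [|b] an //=.
  - by rewrite nth_nseq if_same.
  - by rewrite (nth_map [::]) ?size_stdbasis.
  - by rewrite (nth_map [::]) ?size_stdbasis //= IH.
by rewrite H // -val_eqE.
Qed.

Lemma span_stdbasis : vspan (stdbasis k) = fullv.
Proof.
apply/vspaceP => x; rewrite memvf [x]row_sum_delta; apply/idP.
apply: memv_suml => i _; rewrite memvZ // -dec_stdbasis; apply: mem_dec_span.
by rewrite mem_nth // size_stdbasis.
Qed.

Lemma free_stdbasis : free (map dec (stdbasis k)).
Proof.
by rewrite /free -/(vspan _) span_stdbasis dimvf dim_matrix size_map
  size_stdbasis mul1r eqxx.
Qed.

(** Some coordinate [i] of [x - projv U x] is nonzero. The linear form taking [z] to coordinate [i]
    of [z - projv U z] vanishes on [U] but not at [x], and [y] lists its coefficients. *)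
Lemma separating_dotp (U : {vspace 'rV['F_2]_k}) x : x \notin U ->
  exists2 y, forall z, z \in U -> dotp y z = 0 & dotp y x != 0.
Proof.
move=> xU; have: x - projv U x != 0.
  by apply: contra xU; rewrite subr_eq0 => /eqP ->; apply: memv_proj.
case/rV0Pn=> i wi; pose y : 'rV['F_2]_k := \row_j ('e_j - projv U 'e_j) 0 i.
have yE z : dotp y z = (z - projv U z) 0 i.
  rewrite [in RHS](row_sum_delta z) linear_sum -sumrB summxE.
  by apply: eq_bigr => j _; rewrite linearZ /= -scalerBr !mxE mulrC.
by exists y => [z zU|]; rewrite yE // projv_id // subrr mxE.
Qed.

(** A vector outside the span of [L] is detected by some [y] orthogonal to [L], and [y] lies in the
    span of [perp std L]; the other inclusion is the symmetry of [dotp]. *)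
Lemma perp_perp L : wf k L -> let std := stdbasis k in
  vspan (perp std (perp std L)) = vspan L.
Proof.
move=> wL std; have ws : wf k std := all_stdbasis k.
have mem_std x : x \in vspan std by rewrite span_stdbasis memvf.
have [wp mp _] := perpP ws wL; have [_ mpp _] := perpP ws wp.
apply/vspaceP => x; rewrite mpp mem_std /=; apply/allP/idP => [H|xL e ep].
  apply: contraT => /separating_dotp[y yL]; 
    rewrite dotpC (@span_dotp0 (perp std L)) ?eqxx //.
    by apply/allP => e /H; rewrite dotpC.
  by rewrite mp mem_std; apply/allP => v vL; rewrite dotpC yL ?mem_dec_span.
have := mem_dec_span ep; rewrite mp mem_std /= => /allP H.
by rewrite (span_dotp0 _ xL) //; apply/allP => v /H; rewrite dotpC.
Qed.

Lemma wf_perp std E : wf k std -> wf k E -> wf k (perp std E).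
Proof. by move=> ws /(perpP ws)[]. Qed.

Section Std.
Let std := stdbasis k.
Let ws : wf k std := all_stdbasis k.

Lemma mem_perp E x : wf k E ->
  (x \in vspan (perp std E)) = all (fun e => dotp (dec e) x == 0) E.
Proof. by move=> wE; have [_ -> _] := perpP ws wE; rewrite span_stdbasis memvf. Qed.

Lemma perp_dual L x : wf k L ->
  all (fun e => dotp (dec e) x == 0) (perp std L) = (x \in vspan L).
Proof. by move=> wL; rewrite -mem_perp ?wf_perp // perp_perp. Qed.

Lemma wf_slice e L1 L2 : size e = k -> wf k L1 -> wf k L2 ->
  wf k (slice std e L1 L2).
Proof.
by move=> se w1 w2; apply: wf_perp => //=; rewrite se eqxx all_cat !wf_perp.
Qed.

Lemma mem_slice e L1 L2 x : size e = k -> wf k L1 -> wf k L2 ->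
  (x \in vspan (slice std e L1 L2)) =
  [&& dotp (dec e) x == 0, x \in vspan L1 & x \in vspan L2].
Proof.
move=> se w1 w2; rewrite mem_perp /= ?se ?eqxx ?all_cat ?wf_perp //.
by rewrite !perp_dual.
Qed.

Lemma wf_join L1 L2 : wf k L1 -> wf k L2 -> wf k (join std L1 L2).
Proof. by move=> w1 w2; rewrite !wf_perp // all_cat w1. Qed.

Lemma span_join L1 L2 : wf k L1 -> wf k L2 ->
  vspan (join std L1 L2) = (vspan L1 + vspan L2)%VS.
Proof.
by move=> w1 w2; rewrite perp_perp ?all_cat ?w1 // /vspan map_cat span_cat.
Qed.

End Std.

End Vectors.

(** * Affine spaces of shifts *)

Section Affine.
Variable n : nat.
Implicit Types (s t : 'rV['F_2]_n) (f g : 'rV['F_2]_n -> 'F_2) (p : 'I_n).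

Definition shifts_to f g s : Prop := forall x, f (x + s) = g x.

Definition independent_of p f : Prop :=
  forall x y : 'rV['F_2]_n, (forall j, j != p -> x 0 j = y 0 j) -> f x = f y.

Definition ite p f g : 'rV['F_2]_n -> 'F_2 :=
  fun x => if x 0 p == 1 then f x else g x.

(** Evaluating at points whose coordinate [p] has been set to 0 or 1 isolates each branch, and the
    branches do not notice the change of that coordinate. The value [s 0 p] decides whether the
    shift swaps the branches. *)
Lemma shifts_to_ite p f1 f0 g1 g0 s :
  independent_of p f1 -> independent_of p f0 ->
  independent_of p g1 -> independent_of p g0 ->
  shifts_to (ite p f1 f0) (ite p g1 g0) s <->
  (s 0 p = 0 /\ shifts_to f1 g1 s /\ shifts_to f0 g0 s) \/
  (s 0 p = 1 /\ shifts_to f1 g0 s /\ shifts_to f0 g1 s).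
Proof.
move=> if1 if0 ig1 ig0; pose put (b : 'F_2) (x : 'rV['F_2]_n) :=
  \row_j (if j == p then b else x 0 j).
have putp b x : put b x 0 p = b by rewrite mxE eqxx.
have put_shift h b x : independent_of p h -> h (put b x + s) = h (x + s).
  by move=> ih; apply: ih => j /negbTE jp; rewrite !mxE jp.
have put_same h b x : independent_of p h -> h (put b x) = h x.
  by move=> ih; apply: ih => j /negbTE jp; rewrite !mxE jp.
have z1 : (0 == 1 :> 'F_2) = false by [].
have one1 : 1 + 1 = 0 :> 'F_2 by apply/val_inj.
split=> [H|[[sp [H1 H0]]|[sp [H1 H0]]] x].
- case: (F2_cases (s 0 p)) => sp; [left|right]; do 2 split => //; move=> x.
  + by have := H (put 1 x);
      rewrite /ite mxE putp sp addr0 eqxx put_shift ?put_same.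
  + by have := H (put 0 x);
      rewrite /ite mxE putp sp addr0 ?z1 ?eqxx put_shift ?put_same.
  + by have := H (put 0 x);
      rewrite /ite mxE putp sp add0r ?z1 ?eqxx put_shift ?put_same.
  + by have := H (put 1 x);
      rewrite /ite mxE putp sp one1 ?z1 ?eqxx put_shift ?put_same.
- by rewrite /ite mxE sp addr0 H1 H0.
- rewrite /ite mxE sp; case: (F2_cases (x 0 p)) => ->.
    by rewrite add0r eqxx z1 H1.
  by rewrite one1 z1 H0.
Qed.

(** Over the two-element field, closure under sums of three elements says that a set is empty or an
    affine subspace. *)
Lemma shifts_to_add3 f g s t r : shifts_to f g s -> shifts_to f g t ->
  shifts_to f g r -> shifts_to f g (s + t + r).
Proof.
move=> fs ft fr x.
by rewrite !addrA fr -fs -[x + s + t + s]addrA [t + s]addrC addrA addxK_F2 ft.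
Qed.

Definition homc (c : 'F_2) s : 'rV['F_2]_n.+1 :=
  \row_j oapp (s 0) c (unlift ord0 j).

Lemma homc0E c s : homc c s 0 ord0 = c.
Proof. by rewrite mxE unlift_none. Qed.

Lemma homcSE c s p : homc c s 0 (lift ord0 p) = s 0 p.
Proof. by rewrite mxE liftK. Qed.

Lemma homcD c d s t : homc (c + d) (s + t) = homc c s + homc d t.
Proof. by apply/rowP => j; rewrite !mxE; case: unlift => [p|] /=; rewrite ?mxE. Qed.

Lemma homc_surj (x : 'rV['F_2]_n.+1) :
  x = homc (x 0 ord0) (\row_p x 0 (lift ord0 p)).
Proof.
by apply/rowP => j; rewrite mxE; case: unliftP => [p|] -> /=; rewrite ?mxE.
Qed.

Lemma homc_inj c d s t : homc c s = homc d t -> c = d /\ s = t.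
Proof.
move=> E; split; first by rewrite -(homc0E c s) E homc0E.
by apply/rowP => p; rewrite -(homcSE c s) E homcSE.
Qed.

(** At height 0 the embedding is linear; it will carry spaces of directions into the homogenized
    space. *)
Lemma homc0_is_linear : linear (homc 0).
Proof.
by move=> a s t; apply/rowP => j; rewrite !mxE; case: unlift => [p|] /=;
  rewrite ?mxE // mulr0 addr0.
Qed.
HB.instance Definition _ :=
  GRing.isLinear.Build 'F_2 'rV['F_2]_n 'rV['F_2]_n.+1 _ (homc 0) homc0_is_linear.

Lemma dec_homc (v : vec) : dec n.+1 v = homc (head false v)%:R (dec n (behead v)).
Proof.
apply/rowP => j; rewrite !mxE; case: unliftP => [p|] -> /=.
  by rewrite mxE nth_behead.
by rewrite nth0.
Qed.

Lemma dotp_delta k (i : 'I_k) x : dotp 'e_i x = x 0 i.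
Proof.
rewrite /dotp (bigD1 i) //= mxE !eqxx mul1r big1 ?addr0 // => j ji.
by rewrite mxE (negbTE ji) andbF mul0r.
Qed.

(* A space [U] of vectors [homc c s] stands for the affine space of the [s]
   with [homc 1 s \in U]. *)
Lemma affine_hull_cup (S : 'rV['F_2]_n -> Prop) (U1 U2 : {vspace 'rV['F_2]_n.+1}) :
  (forall s t r, S s -> S t -> S r -> S (s + t + r)) ->
  (forall s, homc 1 s \in U1 -> S s) -> (forall s, homc 1 s \in U2 -> S s) ->
  (U1 = 0%VS \/ exists s, homc 1 s \in U1) ->
  (U2 = 0%VS \/ exists s, homc 1 s \in U2) ->
  forall s, homc 1 s \in (U1 + U2)%VS -> S s.
Proof.
move=> S3 S1 S2 n1 n2 s /memv_addP[a aU1 [b bU2]].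
rewrite (homc_surj a) (homc_surj b) in aU1 bU2 *.
move: (a 0 ord0) (b 0 ord0) (\row_p _) (\row_p _) aU1 bU2 => c d s1 s2.
rewrite -homcD => aU1 bU2 /homc_inj[cd ->] {s a b}.
(* One summand has height 1 and the other height 0. A point [t] at height 1 in [W2] writes the
   latter as a difference of two such points, and [t1 + t2] becomes the triple sum of [t1], [t] and
   [t + t2]. *)
have main (W1 W2 : {vspace 'rV['F_2]_n.+1}) t1 t2 :
    (forall s, homc 1 s \in W1 -> S s) -> (forall s, homc 1 s \in W2 -> S s) ->
    (W2 = 0%VS \/ exists s, homc 1 s \in W2) ->
    homc 1 t1 \in W1 -> homc 0 t2 \in W2 -> S (t1 + t2).
  move=> SW1 SW2 [->|[t tW2]] t1W.
    rewrite memv0 => /eqP /rowP E; rewrite (_ : t2 = 0) ?addr0; first exact: SW1.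
    by apply/rowP => p; have := E (lift ord0 p); rewrite homcSE !mxE.
  move=> t2W; rewrite -(addxK_F2 t t1) -addrA; apply: S3 (SW1 _ t1W) _ _.
    exact: SW2.
  by apply: SW2; rewrite -[1]addr0 homcD memvD.
case: (F2_cases c) cd aU1 => -> cd aU1.
  by move: bU2; rewrite add0r in cd; rewrite -cd addrC => bU2; apply: main bU2 aU1.
have d0 : d = 0 by apply: (addrI 1); rewrite addr0 -cd.
by rewrite d0 in bU2; apply: main aU1 bU2.
Qed.

End Affine.

(** * Lists of generators for affine spaces of shifts *)

Section Represent.
Variable n : nat.
Implicit Types (s t : 'rV['F_2]_n) (f g : 'rV['F_2]_n -> 'F_2) (p : 'I_n).
Implicit Types (L : seq vec) (S : 'rV['F_2]_n -> Prop).
Let std := stdbasis n.+1.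
Let wstd : wf n.+1 std := all_stdbasis n.+1.

Definition rep L S : Prop :=
  wf n.+1 L /\ forall s, homc 1 s \in vspan n.+1 L <-> S s.

Lemma size_std i : (i < n.+1)%N -> size (nth [::] std i) = n.+1.
Proof.
by move=> lti; have /allP/(_ _ (mem_nth [::] _))/eqP := wstd; apply;
   rewrite size_stdbasis.
Qed.

(** A generator of height 1 provides a point of the affine space; without one, the whole span has
    height 0 and [S] is empty. *)
Lemma rep_proper_part L S : rep L S ->
  let U := vspan n.+1 (proper_part L) in
  rep (proper_part L) S /\ (U = 0%VS \/ exists s, homc 1 s \in U).
Proof.
case=> wL H; rewrite /proper_part; case: ifP => [/hasP[v vL hv]|/hasPn nh].
  split=> //; right; exists (dec n (behead v)).
  by have := mem_dec_span n.+1 vL; rewrite dec_homc hv.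
have span0 : vspan n.+1 [::] = 0%VS by rewrite /vspan span_nil.
split; last by left.
split=> // s; rewrite span0 memv0 -H; split=> [/eqP/rowP/(_ ord0)|sL].
  by rewrite homc0E mxE.
suff: dotp 'e_ord0 (homc 1 s) = 0 by rewrite dotp_delta homc0E.
apply: span_dotp0 sL; apply/allP => v /nh hv.
by rewrite dotp_delta dec_homc homc0E (negbTE hv).
Qed.

Lemma rep_slice e L1 L2 S1 S2 : size e = n.+1 -> rep L1 S1 -> rep L2 S2 ->
  rep (slice std e L1 L2)
    (fun s => dotp (dec n.+1 e) (homc 1 s) = 0 /\ S1 s /\ S2 s).
Proof.
move=> se [w1 H1] [w2 H2]; split; first exact: wf_slice.
move=> s; rewrite mem_slice //; split.
  by case/and3P=> /eqP e0 /H1 s1 /H2 s2.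
by case=> e0 [/H1 s1 /H2 s2]; rewrite e0 eqxx s1 s2.
Qed.

(** The union [S] is itself closed under triple sums, so passing to the sum of the spans adds no new
    points. *)
Lemma rep_join L1 L2 S1 S2 S :
  (forall s, S s <-> S1 s \/ S2 s) ->
  (forall s t r, S s -> S t -> S r -> S (s + t + r)) ->
  rep L1 S1 -> rep L2 S2 ->
  rep (join std (proper_part L1) (proper_part L2)) S.
Proof.
move=> SE S3 /rep_proper_part[[w1 H1] n1] /rep_proper_part[[w2 H2] n2].
split; first exact: wf_join.
move=> s; rewrite span_join //; split.
  by apply: affine_hull_cup => // t; [move/H1|move/H2] => ?; apply/SE; auto.
case/SE => [/H1|/H2] sL; first by rewrite -[homc 1 s]addr0 memv_add ?mem0v.
by rewrite -[homc 1 s]add0r memv_add ?mem0v.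
Qed.

Lemma rep_combine tbl p A B C D f1 f0 g1 g0 :
  independent_of p f1 -> independent_of p f0 ->
  independent_of p g1 -> independent_of p g0 ->
  rep (get tbl A C) (shifts_to f1 g1) -> rep (get tbl B D) (shifts_to f0 g0) ->
  rep (get tbl A D) (shifts_to f1 g0) -> rep (get tbl B C) (shifts_to f0 g1) ->
  rep (combine std tbl p A B C D) (shifts_to (ite p f1 f0) (ite p g1 g0)).
Proof.
move=> if1 if0 ig1 ig0 rAC rBD rAD rBC.
have decp : dec n.+1 (nth [::] std p.+1) = 'e_(lift ord0 p).
  by rewrite -dec_stdbasis.
have dec0 : dec n.+1 (nth [::] std 0) = 'e_ord0 by rewrite -dec_stdbasis.
have sp : size (nth [::] std p.+1) = n.+1 by apply: size_std; rewrite ltnS.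
have s0 : size (nth [::] std 0) = n.+1 by apply: size_std.
apply: rep_join (rep_slice _ rAC rBD) (rep_slice _ rAD rBC) => //.
- move=> s; rewrite shifts_to_ite // dec_xorv // decp dec0 dotpDl.
  rewrite !dotp_delta homcSE homc0E.
  (* At height 1 the sum of basis vectors [p.+1] and 0 expresses the equation [s 0 p + 1 = 0]. *)
  have H : s 0 p + 1 = 0 <-> s 0 p = 1.
    by case: (F2_cases (s 0 p)) => ->; split=> // _; apply/val_inj.
  tauto.
- by move=> s t r; apply: shifts_to_add3.
- by rewrite size_xorv sp s0 minnn.
Qed.
End Represent.

(** [FP] concerns fixed types, so the bounds on the names are forgotten; the code of the sum type
    agrees with [enc_node]. *)
Definition raw_node n N (v : node n N) : rawnode :=
  match v with
  | Leaf b => inl (b != 0)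
  | Branch p A B => inr (nat_of_ord p, (nat_of_ord A, nat_of_ord B))
  end.

Definition raw_order n (lt : rel 'I_n) : seq (seq bool) :=
  [seq [seq lt p q | q <- enum 'I_n] | p <- enum 'I_n].

Lemma nth_raw_order n (lt : rel 'I_n) (p q : 'I_n) :
  nth false (nth [::] (raw_order lt) p) q = lt p q.
Proof.
rewrite (nth_map p) ?size_enum_ord // nth_ord_enum.
by rewrite (nth_map p) ?size_enum_ord // nth_ord_enum.
Qed.

(** * Correctness of the table *)

Section Diagram.
Variables (n m : nat) (lt : rel 'I_n) (D : bdd n m).
Hypotheses (lt_total : strict_total_order lt) (ord_D : ordered lt D).
Let N := bdd_size D.
Implicit Types (i j A B : 'I_N) (p q : 'I_n).

(** Labels increase along the evaluation path, so every variable tested on it lies above [p]. *)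
Lemma evaluates_independent x i b p : evaluates D x i b ->
  label_above lt p (node_at D i) ->
  forall y : 'rV['F_2]_n, (forall j : 'I_n, j != p -> x 0 j = y 0 j) ->
    evaluates D y i b.
Proof.
have [irr tr _] := lt_total.
have up q A : lt p q -> label_above lt q (node_at D A) ->
    label_above lt p (node_at D A).
  by case: (node_at D A) => //= r _ _; apply: tr.
elim=> {i b} [i b E _ y xy|i q A B b E xq _ IH|i q A B b E xq _ IH].
- exact: evaluates_leaf E.
- rewrite E /= => pq y xy; have [hA _] := ord_D E.
  apply: evaluates_then E _ (IH (up _ _ pq hA) y xy).
  by rewrite -xy //; apply: contraTneq pq => ->; rewrite irr.
- rewrite E /= => pq y xy; have [_ hB] := ord_D E.
  apply: evaluates_else E _ (IH (up _ _ pq hB) y xy).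
  by rewrite -xy //; apply: contraTneq pq => ->; rewrite irr.
Qed.

Variable val : 'I_N -> 'rV['F_2]_n -> 'F_2.
Hypothesis evaluates_val : forall i x, evaluates D x i (val i x).

Lemma val_leaf i b x : node_at D i = Leaf b -> val i x = b.
Proof.
by move=> E; apply: evaluates_fun (evaluates_val i x) _; apply: evaluates_leaf.
Qed.

Lemma val_branch i p A B : node_at D i = Branch p A B ->
  val i =1 ite p (val A) (val B).
Proof.
move=> E x; apply: evaluates_fun (evaluates_val i x) _; rewrite /ite.
case: (F2_cases (x 0 p)) => xp; rewrite xp.
  exact: evaluates_else E xp (evaluates_val B x).
exact: evaluates_then E xp (evaluates_val A x).
Qed.

Lemma val_independent p i : label_above lt p (node_at D i) ->
  independent_of p (val i).
Proof.
move=> h x y xy; apply: evaluates_fun (evaluates_val i y).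
exact: evaluates_independent (evaluates_val i x) h y xy.
Qed.

Definition rank i : nat :=
  if node_at D i is Branch p _ _ then #|[set q | lt p q]|.+1 else 0.

Lemma rank_le i : (rank i <= n)%N.
Proof.
have [irr _ _] := lt_total; rewrite /rank; case: (node_at D i) => // p _ _.
rewrite -[n in (_ <= n)%N]card_ord -cardsT; apply: proper_card; rewrite properT.
by apply/eqP => /setP/(_ p); rewrite !inE irr.
Qed.

Lemma rank_above p i : label_above lt p (node_at D i) ->
  (rank i <= #|[set q | lt p q]|)%N.
Proof.
have [irr tr _] := lt_total; rewrite /rank; case: (node_at D i) => //= q _ _ pq.
apply: proper_card; apply/properP; split; last by exists q; rewrite !inE ?irr.
by apply/subsetP => r; rewrite !inE; apply: tr.
Qed.

Let std := stdbasis n.+1.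
Let nodes := map (@raw_node n N) (bdd_nodes D).

Lemma nth_nodes i : nth (inl false) nodes i = raw_node (node_at D i).
Proof.
rewrite /nodes (nth_map (node_at D i)) ?size_tuple //.
by rewrite [in RHS]/node_at (tnth_nth (node_at D i)).
Qed.

Definition correct_upto r tbl := forall i j, (rank i < r)%N -> (rank j < r)%N ->
  rep (get tbl i j) (shifts_to (val i) (val j)).

Lemma rep_ext L (S1 S2 : 'rV['F_2]_n -> Prop) :
  (forall s, S1 s <-> S2 s) -> rep L S1 -> rep L S2.
Proof. by move=> E [w H]; split=> // s; rewrite H. Qed.

Lemma correct_combine r tbl p i j (A B C E : 'I_N) : correct_upto r tbl ->
  val i =1 ite p (val A) (val B) -> val j =1 ite p (val C) (val E) ->
  all (fun h => label_above lt p (node_at D h)) [:: A; B; C; E] ->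
  (#|[set q | lt p q]| < r)%N ->
  rep (combine std tbl p A B C E) (shifts_to (val i) (val j)).
Proof.
move=> cor vi vj /= /and5P[hA hB hC hE _] pr.
have rk h : label_above lt p (node_at D h) -> (rank h < r)%N.
  by move/rank_above => le; apply: leq_ltn_trans pr.
apply: (@rep_ext _ (shifts_to (ite p (val A) (val B)) (ite p (val C) (val E)))).
  by move=> s; split=> H x; [rewrite vi vj|rewrite -vi -vj].
by apply: rep_combine; try (apply: val_independent => //); apply: cor; apply: rk.
Qed.

Lemma ite_same p h : val h =1 ite p (val h) (val h).
Proof. by move=> x; rewrite /ite if_same. Qed.

(** The branching variable is the smaller of the labels, so a vertex that is not split has its label
    above it. Like the children, it then has rank below [r], and all four entries read by [combine]
    are already correct. *)
Lemma correct_entry r tbl i j : correct_upto r tbl ->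
  (rank i < r.+1)%N -> (rank j < r.+1)%N ->
  rep (entry std (raw_order lt) nodes tbl i j) (shifts_to (val i) (val j)).
Proof.
move=> cor; rewrite /entry !nth_nodes /rank.
case Ei: (node_at D i) => [a|p A B]; case Ej: (node_at D j) => [b|q C E] /=.
- move=> _ _; split; first by case: ifP => //; rewrite all_stdbasis.
  move=> s; rewrite /shifts_to.
  have vE x : (val i (x + s) = val j x) <-> (a = b).
    by rewrite (val_leaf _ Ei) (val_leaf _ Ej).
  case: (F2_cases a) vE => ->; case: (F2_cases b) => -> /= vE;
    rewrite ?span_stdbasis ?memvf /vspan ?span_nil ?memv0; split=> //.
  + by move=> _ x; apply/vE.
  + by move/eqP/rowP/(_ ord0); rewrite homc0E mxE.
  + by move/(_ 0)/vE.
  + by move/eqP/rowP/(_ ord0); rewrite homc0E mxE.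
  + by move/(_ 0)/vE.
  + by move=> _ x; apply/vE.
- move=> _ qr; have [hC hE] := ord_D Ej.
  apply: correct_combine cor (ite_same q i) (val_branch Ej) _ qr.
  by rewrite /= hC hE Ei.
- move=> pr _; have [hA hB] := ord_D Ei.
  apply: correct_combine cor (val_branch Ei) (ite_same p j) _ pr.
  by rewrite /= hA hB Ej.
- move=> pr qr; have [hA hB] := ord_D Ei; have [hC hE] := ord_D Ej.
  rewrite !nth_raw_order; case: ifP => pq.
    apply: correct_combine cor (val_branch Ei) (ite_same p j) _ pr.
    by rewrite /= hA hB Ej /= pq.
  case: ifP => qp.
    apply: correct_combine cor (ite_same q i) (val_branch Ej) _ qr.
    by rewrite /= hC hE Ei /= qp.
  have [_ _ tot] := lt_total.
  have pqE : p = q by apply/eqP/idPn => /tot; rewrite pq qp.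
  rewrite -{}pqE in Ej hC hE *.
  apply: correct_combine cor (val_branch Ei) (val_branch Ej) _ pr.
  by rewrite /= hA hB hC hE.
Qed.

Let tbl := table std (raw_order lt) nodes (iota 0 (size nodes)).

Lemma correct_table i j : rep (get tbl i j) (shifts_to (val i) (val j)).
Proof.
have sz : size nodes = N by rewrite size_map size_tuple.
have get_round t h k : get (round std (raw_order lt) nodes (iota 0 (size nodes)) t)
    (h : 'I_N) (k : 'I_N) = entry std (raw_order lt) nodes t h k.
  have nthI (l : 'I_N) : nth 0 (iota 0 N) l = l by rewrite nth_iota.
  by rewrite /get sz !(nth_map 0) ?size_iota // !nthI.
suff cor l : correct_upto (size l) (foldl (fun t (_ : vec) =>
    round std (raw_order lt) nodes (iota 0 (size nodes)) t) [::] l).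
  (* Ranks are at most [n] and [std] has [n.+1] elements, so the last round reaches every vertex. *)
  by apply: (cor std); rewrite size_stdbasis ltnS rank_le.
elim/last_ind: l => [|l v IH] h k //; rewrite size_rcons foldl_rcons get_round.
exact: correct_entry.
Qed.
End Diagram.

(** Since [S j] contains 0, adding [homc 1 0] shows that [homc 0 s] lies in the span for [j] exactly
    when [S j s] holds. The equation of coordinate 0 restricts [perp] to such vectors, which
    [behead] sends back to [s]. *)
Lemma invariance_basis n (tbl : seq (seq (seq vec)))
    (S : nat -> 'rV['F_2]_n -> Prop) (outs : seq nat) :
  (forall j, j \in outs -> rep (get tbl j j) (S j)) ->
  (forall j, j \in outs -> S j 0) ->
  let B := invariance (stdbasis n.+1) tbl outs in
  [/\ wf n B, free (map (dec n) B)
    & forall s, s \in vspan n B <-> forall j, j \in outs -> S j s].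
Proof.
move=> rS S0; set std := stdbasis n.+1; rewrite /invariance -/std.
set E := _ :: _; set P := perp std E; set B := map behead P.
have wstd : wf n.+1 std := all_stdbasis n.+1.
have dec0 : dec n.+1 (nth [::] std 0) = 'e_ord0 by rewrite -dec_stdbasis.
have wE : wf n.+1 E.
  apply/andP; split; first by rewrite size_std.
  apply/allP => v /flattenP[_ /mapP[j jo ->]] vj.
  by have [wj _] := rS j jo; have /allP/(_ v vj) := wf_perp wstd wj.
have [wP memP freeP] := perpP wstd wE.
have headP v : v \in P -> head false v = false.
  move/(mem_dec_span n.+1); rewrite memP /= dec0 dotp_delta dec_homc homc0E.
  by case/and3P=> _; rewrite natr_bool_eq0 => /negbTE.
have decP : map (dec n.+1) P = map (linfun (homc 0)) (map (dec n) B).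
  rewrite /B -!map_comp; apply/eq_in_map => v /headP hv.
  by rewrite /= lfunE /= dec_homc hv.
have spanP : vspan n.+1 P = (linfun (homc 0) @: vspan n B)%VS.
  by rewrite limg_span /vspan decP.
split.
- apply/allP => _ /mapP[v vP ->]; rewrite size_behead.
  by rewrite (eqP (allP wP v vP)).
(* A linear map does not raise dimensions, so the span of [B] has at least the dimension of its
   image, which is the number of vectors. *)
- have := freeP (free_stdbasis n.+1); rewrite decP /free -limg_span size_map.
  move=> /eqP dimE; rewrite eqn_leq dim_span -{1}dimE /=.
  by rewrite -[X in (_ <= X)%N](limg_ker_dim (linfun (homc 0))) leq_addl.
- move=> s; have -> : (s \in vspan n B) = (homc 0 s \in vspan n.+1 P).
    rewrite spanP; apply/idP/memv_imgP => [sB|[t tB]].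
      by exists s; rewrite ?lfunE.
    by rewrite lfunE => /homc_inj[_ ->].
  have slice0 j : j \in outs -> (homc 0 s \in vspan n.+1 (get tbl j j)) <-> S j s.
    move=> jo; have [wj Hj] := rS j jo; have /Hj h0 := S0 j jo.
    rewrite -Hj -[in X in _ <-> X](add0r s) -{1}(addr0 1) homcD.
    by rewrite rpredDl.
  rewrite memP span_stdbasis memvf /= dec0 dotp_delta homc0E eqxx /=.
  split=> [/allP H j jo|H].
    have [wj _] := rS j jo; apply/slice0 => //; rewrite -perp_dual //.
    by apply/allP => v vj; apply: H; apply/flattenP;
      exists (perp std (get tbl j j)) => //; apply: map_f.
  apply/allP => v /flattenP[_ /mapP[j jo ->]] vj.
  have [wj _] := rS j jo; have /slice0 := H j jo; rewrite -perp_dual // => /(_ jo).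
  by move=> /allP/(_ v vj).
Qed.

(** * Codes of inputs and outputs *)

Definition raw_input n m (lt : rel 'I_n) (D : bdd n m) :
    (nat * seq (seq bool)) * (seq rawnode * seq nat) :=
  ((n, raw_order lt), (map (@raw_node n _) (bdd_nodes D),
                       map (@nat_of_ord _) (bdd_outputs D))).

Lemma enc_seq_map X Y (EY : Enc Y) (f : X -> Y) s :
  enc (map f s) = enc_seq (fun x => enc (f x)) s.
Proof. by elim: s => //= x s IH; rewrite -IH. Qed.

Lemma eq_enc_seq X (f g : X -> tree) : f =1 g -> enc_seq f =1 enc_seq g.
Proof. by move=> fg; elim=> //= x s ->; rewrite fg. Qed.

Lemma enc_raw_input n m (lt : rel 'I_n) (D : bdd n m) :
  enc (raw_input lt D) = enc_obdd lt D.
Proof.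
rewrite /enc_obdd -[LHS]/(Cons (Cons (enc n) (enc (raw_order lt)))
  (Cons (enc (map (@raw_node n _) (bdd_nodes D)))
        (enc (map (@nat_of_ord _) (bdd_outputs D))))).
rewrite !enc_seq_map; congr (Cons (Cons _ _) (Cons _ _)).
  by apply: eq_enc_seq => p; rewrite enc_seq_map.
by apply: eq_enc_seq; case.
Qed.

(** The bound is quadratic: the order is a table of [n * n] bits, and each vertex carries unary
    names of linear length. *)
Lemma esize_raw_input n m (lt : rel 'I_n) (D : bdd n m) :
  (esize (raw_input lt D) <= let M := n + m + bdd_size D in
     M * (12 * M + 30) + 20)%N.
Proof.
set M := (_ + _)%N; rewrite /= /raw_input !esize_pair esize_nat.
have H1 : (esize (raw_order lt) <= n * (n * 4 + 1).+1 + 1)%N.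
  apply: esize_map_le => [|p]; first by rewrite size_enum_ord.
  by apply: esize_map_le => [|q]; rewrite ?size_enum_ord // esize_bool.
have H2 : (esize (map (@raw_node n _) (bdd_nodes D)) <=
    bdd_size D * (6 * M + 19).+1 + 1)%N.
  apply: esize_map_le => [|v]; first by rewrite size_tuple.
  case: v => [b|p A B] /=; first by rewrite /esize /enc /=; case: eqP => _ /=; lia.
  change (esize (true, (nat_of_ord p, (nat_of_ord A, nat_of_ord B))) <= 6 * M + 19)%N.
  rewrite !esize_pair !esize_nat; have := ltn_ord p; have := ltn_ord A.
  by have := ltn_ord B; have := esize_bool true; rewrite /M; lia.
have H3 : (esize (map (@nat_of_ord _) (bdd_outputs D)) <=
    m * (2 * M + 1).+1 + 1)%N.
  apply: esize_map_le => [|i]; first by rewrite size_tuple.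
  by rewrite esize_nat; have := ltn_ord i; rewrite /M; lia.
have [nM mM NM] : [/\ n <= M, m <= M & bdd_size D <= M]%N by rewrite /M; split; lia.
have L1 : (n * (n * 4 + 1).+1 <= M * (M * 4 + 1).+1)%N.
  by rewrite leq_mul // ltnS leq_add2r leq_mul2r nM orbT.
have L2 : (bdd_size D * (6 * M + 19).+1 <= M * (6 * M + 19).+1)%N.
  by rewrite leq_mul2r NM orbT.
have L3 : (m * (2 * M + 1).+1 <= M * (2 * M + 1).+1)%N by rewrite leq_mul2r mM orbT.
move: H1 H2 H3 L1 L2 L3 nM; set a := esize _; set b := esize _; set c := esize _.
clearbody M a b c; move: (n * _)%N (bdd_size D * _)%N (m * _)%N => x y z.
by rewrite !mulnS !mulnDr !muln0; lia.
Qed.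

Lemma enc_vectors_dec n (B : seq vec) : wf n B ->
  enc_vectors (map (dec n) B) = enc B.
Proof.
elim: B => //= v B IH /andP[/eqP sv /IH{}IH].
rewrite /enc_vectors /= -/(enc_vectors _) IH.
rewrite -[RHS]/(Cons (enc v) (enc B)); congr Cons.
rewrite /enc_vector -{}sv -[v in RHS](mkseq_nth false) /mkseq -val_enum_ord.
rewrite -map_comp enc_seq_map; apply: eq_enc_seq => i /=.
by rewrite mxE /enc_bit natr_bool_eq0 negbK.
Qed.

(** Choosing for every variable a vertex labeled by it is injective, because a vertex has only one
    label. *)
Lemma variables_le_size n m (D : bdd n m) :
  all_variables_occur D -> (n <= bdd_size D)%N.
Proof.
case/fin_all_exists => h hP.
rewrite -[n in (n <= _)%N]card_ord -[X in (_ <= X)%N]card_ord.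
apply: (leq_card h) => p q E; have [A [B Ep]] := hP p; have [A' [B' Eq]] := hP q.
by move: Eq; rewrite -E Ep => -[].
Qed.

(** In general the number of vertices bounds neither [n] nor [m]. [T] is for diagrams where it
    bounds both, and [T'] counts all three numbers. *)
Theorem theorem2 :
  exists (P : cmd) (T T' : {poly nat}),
  forall (n m : nat) (lt : rel 'I_n) (D : bdd n m)
    (f : 'rV['F_2]_n -> 'rV['F_2]_m),
    strict_total_order lt ->
    ordered lt D ->
    represents D f ->
    exists (b : seq 'rV['F_2]_n) (t : nat),
      [/\ runs P (enc_obdd lt D) t (enc_vectors b),
          is_basis (V f) b,
          all_variables_occur D -> uniq (bdd_outputs D) ->
            (t <= T.[bdd_size D])%N
        & (t <= T'.[(n + m + bdd_size D)%N])%N].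
Proof.
have [U [pU _ /(_ 0)[P runP]]] := FP_main.
pose time M := U (M * (12 * M + 30) + 20)%N.
have p_time : pbound time by rewrite /time; pbound.
(* When [n] and [m] are at most the number [N] of vertices, the three numbers sum to at most
   [3 * N]. *)
have p_time3 : pbound (fun N => time (3 * N)%N) by pbound.
have [T' T'E] := pbound_poly p_time; have [T TE] := pbound_poly p_time3.
exists P, T, T' => n m lt D f lt_total ord_D repD.
have [val evaluates_val] : exists val, forall i x, evaluates D x i (val i x).
  apply: (@fin_all_exists _ _ (fun i v => forall x, evaluates D x i (v x))) => i.
  apply: (@fin_all_exists _ _ (fun x b => evaluates D x i b)) => x.
  exact: ordered_evaluates lt_total ord_D x i.
have f_val x j : f x 0 j = val (tnth (bdd_outputs D) j) x.
  exact: evaluates_fun (repD x j) (evaluates_val _ x).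
(* The algorithm handles plain numbers, so the condition is stated for the vertex with number
   [j]. *)
pose S j s := forall i : 'I_(bdd_size D), j = i :> nat ->
  shifts_to (val i) (val i) s.
pose tbl := table (stdbasis n.+1) (raw_order lt) (raw_input lt D).2.1
  (iota 0 (size (raw_input lt D).2.1)).
have [||wB freeB memB] := @invariance_basis n tbl S (raw_input lt D).2.2.
- move=> _ /mapP[i _ ->]; apply: rep_ext (correct_table lt_total ord_D evaluates_val i i).
  by move=> s; split=> [H k /val_inj <-|]; last apply.
- by move=> j _ i _ x; rewrite addr0.
set B := invariance _ _ _ in wB freeB memB.
have [t [st [ex le_t st0 _]]] :=
  runP (fun k => if k == 0%N then enc (raw_input lt D) else Nil) _ erefl.
have le_time : (t <= time (n + m + bdd_size D))%N.
  by apply: leq_trans le_t _; apply: pbound_homo pU _ _ (esize_raw_input lt D).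
exists (map (dec n) B), t; split.
- by exists st; split; [rewrite -enc_raw_input|rewrite st0 enc_vectors_dec].
- split=> // s; rewrite -/(vspan n B); apply/idP/idP => [/memB H|].
    rewrite inE; apply/forallP => x; apply/eqP/rowP => j; rewrite !f_val.
    by apply: (H (tnth (bdd_outputs D) j)) => //; apply: map_f; apply: mem_tnth.
  rewrite inE => /forallP H; apply/memB => _ /mapP[i iD ->] k /val_inj <- x.
  by have /tnthP[j ->] := iD; rewrite -!f_val (eqP (H x)).
- move=> /variables_le_size nN uD; rewrite -TE; apply: leq_trans le_time _.
  apply: pbound_homo p_time _ _ _.
  (* Distinct outputs are at most as many as the vertices. *)
  have : (m <= bdd_size D)%N.
    have := max_card (mem (bdd_outputs D)).
    by rewrite (card_uniqP uD) size_tuple card_ord.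
  by lia.
- by rewrite -T'E.
Qed.
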